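(* Let $d\ge2$ be fixed, and let $P_N^{\mathrm{LHS}}$ be a random Latin hypercube sample of $N$ points in $[0,1]^d$. Then, as $N\to\infty$, $$ R_\infty(P_N^{\mathrm{LHS}})=\Theta_{\mathbb P}(N^{-2/d}), \qquad h_\infty(P_N^{\mathrm{LHS}})=\Theta_{\mathbb P}\left(\left(\frac{\log N}{N}\right)^{1/d}\right), $$ and consequently $$ \rho_\infty(P_N^{\mathrm{LHS}})=\Theta_{\mathbb P}\left(N^{1/d}(\log N)^{1/d}\right). $$
   Context: Random Latin hypercube sampling: let $\pi_1,\dots,\pi_d$ be independent uniformly distributed permutations of $\{0,\dots,N-1\}$, and let $U_{i,j}$ ($0\le i<N$, $1\le j\le d$) be independent uniform random variables on $[0,1)$, independent of the permutations. Put $\boldsymbol X_i=\left(\frac{\pi_1(i)+U_{i,1}}{N},\dots,\frac{\pi_d(i)+U_{i,d}}{N}\right)$ for $i=0,\dots,N-1$, and $P_N^{\mathrm{LHS}}=(\boldsymbol X_i)_{0\le i<N}$. For an $N$-point multiset $P=(\boldsymbol x_n)_{0\le n<N}$ in $[0,1]^d$ with $N\ge2$: $R_\infty(P)=\min_{n<n'}\|\boldsymbol x_n-\boldsymbol x_{n'}\|_\infty$, $h_\infty(P)=\sup_{\boldsymbol z\in[0,1]^d}\min_{0\le n<N}\|\boldsymbol z-\boldsymbol x_n\|_\infty$, and the mesh ratio is $\rho_\infty(P)=2h_\infty(P)/R_\infty(P)$, with $\rho_\infty(P)=\infty$ if $R_\infty(P)=0$. Probabilistic order: for random variables $X_N$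 and positive deterministic $a_N$, $X_N=O_{\mathbb P}(a_N)$ means that for every $\varepsilon>0$ there are $C_\varepsilon>0$ and $N_\varepsilon$ with $\mathbb P(|X_N|>C_\varepsilon a_N)\le\varepsilon$ for all $N\ge N_\varepsilon$. For positive random variables, $X_N=\Omega_{\mathbb P}(a_N)$ means $a_N/X_N=O_{\mathbb P}(1)$, and $X_N=\Theta_{\mathbb P}(a_N)$ means both. *)

(* Defs.v *)
From HB Require Import structures.
From mathcomp Require Import all_boot all_order all_algebra all_fingroup.
From mathcomp Require Import all_classical all_reals all_analysis.

Set Implicit Arguments.
Unset Strict Implicit.
Unset Printing Implicit Defensive.

Import Order.TTheory GRing.Theory Num.Theory.
Import numFieldNormedType.Exports.

Local Open Scope classical_set_scope.
Local Open Scope ring_scope.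

Definition unit_cube (R : realType) (d : nat) : set 'rV[R]_d :=
  [set z | forall j : 'I_d, 0 <= z ord0 j <= 1].
Arguments unit_cube : clear implicits.

(* In the next two definitions the norm `|.| of 'rV[R]_d is the library's
   mx_norm, which is the sup-norm.  Values are taken in \bar R, so that an
   empty minimum is +oo; this only occurs for N < 2, resp. N = 0. *)
Definition separation (R : realType) (d N : nat) (x : 'I_N -> 'rV[R]_d) :
    \bar R :=
  \big[Order.min/+oo%E]_(p : 'I_N * 'I_N | (p.1 < p.2)%N)
    (`|x p.1 - x p.2|)%:E.

Definition covering_radius (R : realType) (d N : nat) (x : 'I_N -> 'rV[R]_d) :
    \bar R :=
  ereal_sup [set \big[Order.min/+oo%E]_(n < N) (`|z - x n|)%:E
            | z in unit_cube R d].

Definition mesh_ratio (R : realType) (d N : nat) (x : 'I_N -> 'rV[R]_d) :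
    \bar R :=
  if separation x == 0%E then +oo%E
  else (2%:E * covering_radius x / separation x)%E.

Definition mutually_independent (R : realType) (dO : measure_display)
    (Omega : measurableType dO) (P : probability Omega R) (I : finType)
    (F : I -> set (set Omega)) : Prop :=
  forall (J : {set I}) (E : I -> set Omega),
    (forall i, i \in J -> F i (E i)) ->
    P (\bigcap_(i in [set` J]) E i) = (\prod_(i in J) P (E i))%E.

(* The sigma-algebras generated by the permutations and by the U_ij; 'S_N is
   finite, so all of its subsets are measurable. *)
Definition lhs_sigma (R : realType) (dO : measure_display)
    (Omega : measurableType dO) (P : probability Omega R) (d N : nat)
    (perm : 'I_d -> Omega -> 'S_N) (U : 'I_N -> 'I_d -> {RV P >-> R})
    (k : 'I_d + 'I_N * 'I_d) : set (set Omega) :=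
  match k with
  | inl j => preimage_set_system setT (perm j) setT
  | inr ij => preimage_set_system setT (U ij.1 ij.2) measurable
  end.

(* uniform_prob ltr01 is the uniform law on [0, 1], which is also the one on
   [0, 1). *)
Record lhs_randomness (R : realType) (dO : measure_display)
    (Omega : measurableType dO) (P : probability Omega R) (d N : nat)
    (perm : 'I_d -> Omega -> 'S_N) (U : 'I_N -> 'I_d -> {RV P >-> R}) :
    Prop := {
  lhs_perm_measurable : forall (j : 'I_d) (s : 'S_N),
    measurable (perm j @^-1` [set s]);
  lhs_perm_uniform : forall (j : 'I_d) (s : 'S_N),
    P (perm j @^-1` [set s]) = ((N`!%:R)^-1)%:E;
  lhs_U_uniform : forall (i : 'I_N) (j : 'I_d) (A : set R), measurable A ->
    distribution P (U i j) A = uniform_prob (@ltr01 R) A;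
  lhs_independent : mutually_independent P (lhs_sigma perm U)
}.

Definition lhs_sample (R : realType) (dO : measure_display)
    (Omega : measurableType dO) (P : probability Omega R) (d N : nat)
    (perm : 'I_d -> Omega -> 'S_N) (U : 'I_N -> 'I_d -> {RV P >-> R})
    (w : Omega) (i : 'I_N) : 'rV[R]_d :=
  \row_j (((perm j w i)%:R + U i j w) / N%:R).

(* The X N may live on different probability spaces.  As usual for a random
   variable, X N is meant to be measurable: P N says nothing about
   non-measurable sets. *)
Definition bigO_proba (R : realType) (dO : nat -> measure_display)
    (Omega : forall N, measurableType (dO N))
    (P : forall N, probability (Omega N) R)
    (X : forall N, Omega N -> \bar R) (a : nat -> R) : Prop :=
  forall eps : R, 0 < eps ->
    exists2 C : R, 0 < C &
    exists N0 : nat, forall N, (N0 <= N)%N ->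
      (P N [set w | (C * a N)%:E < `|X N w|] <= eps%:E)%E.

(* In \bar R, 0^-1 = +oo and +oo^-1 = 0, so that X N w = 0 counts against the
   lower bound and X N w = +oo does not. *)
Definition bigOmega_proba (R : realType) (dO : nat -> measure_display)
    (Omega : forall N, measurableType (dO N))
    (P : forall N, probability (Omega N) R)
    (X : forall N, Omega N -> \bar R) (a : nat -> R) : Prop :=
  bigO_proba P (fun N w => ((a N)%:E / X N w)%E) (fun=> 1).

Definition bigTheta_proba (R : realType) (dO : nat -> measure_display)
    (Omega : forall N, measurableType (dO N))
    (P : forall N, probability (Omega N) R)
    (X : forall N, Omega N -> \bar R) (a : nat -> R) : Prop :=
  bigO_proba P X a /\ bigOmega_proba P X a.

(* Main.v *)
Require Import Defs.
From HB Require Import structures.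
From mathcomp Require Import all_boot all_order all_algebra all_fingroup.
From mathcomp Require Import all_classical all_reals all_analysis.
From mathcomp Require Import measurable_realfun.
From mathcomp Require Import zify ring lra.

Set Implicit Arguments.
Unset Strict Implicit.
Unset Printing Implicit Defensive.

Import Order.TTheory GRing.Theory Num.Theory.
Import numFieldNormedType.Exports.

Local Open Scope ring_scope.

(** Every point of the sample is determined, up to an error [1 / N] per
    coordinate, by the family [r] of [d] independent uniform permutations, so
    that, except for very small distances, the geometry of the sample is a
    counting problem on [{ffun 'I_d -> 'S_N}].  The four tail bounds rest on
    one device, revealing.  If a function of a uniform permutation [s] only
    depends on the images of the points of [D], then conditionally on it the
    image of a point outside [D] is uniform among the values not yet taken.  In
    the form used here: the image of [x] may be replaced by the image of any
    other [y] outside [D], because [tperm x y * s] is uniform too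
    ([mean_reveal], [mean_reveal_family]).

    - Covering radius.  Composing the permutations with the inverse of the
      first one, one may list the points by their first coordinate.  A box is
      then hit when one of the indices in its first side is sent by all the
      other permutations into the corresponding sides.  Revealing these indices
      one by one, each of them hits with conditional probability at least
      [((l / 2) / N) ^ (d - 1)] as long as at most half of the [l] cells of a
      side are used up, hence a box of side [l / N] is missed with probability
      at most [exp (- c N (l / N) ^ d)] ([mean_box_missed_le]).  A union bound
      over a grid of boxes gives the upper bound of order
      [(ln N / N) ^ (1 / d)] ([covering_upper]).  Conversely, for disjoint
      boxes along the diagonal, each box is missed, given the previous ones,
      with probability at least [N ^ (- c)] for a small [c]; there are about
      [(N / ln N) ^ (1 / d)] of them, so that one is missed with high
      probability ([mean_all_hit_le], [covering_lower]).

    - Separation, lower bound.  Two given points are at distance at most [t]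
      with probability at most [(4 t) ^ d]; a union bound over the pairs
      suffices ([separation_lower]).  For [d = 2] the relevant [t] is below
      [1 / N], so that here the uniform variables matter: for cells at distance
      [k >= 1] the probability is bounded by [min (s, k) - min (s, k - 1)] with
      [s = N t], and these bounds telescope.

    - Separation, upper bound.  This is a birthday problem, solved by the
      second moment method.  Let [p] be the probability that a permutation
      sends two given points to values at distance at most [m].  Two disjoint
      pairs are both close with probability at most
      [p ^ 2 * N (N - 1) / ((N - 2) (N - 3))], so that the number of close pairs
      has a variance negligible with respect to the square of its mean as soon
      as the mean is large ([second_moment], [mean_no_close_pair_le],
      [separation_upper]).

    The mesh ratio is controlled on the events where the separation and the
    covering radius are.  Monotonicity of the probability only holds for
    measurable events, hence the three quantities are shown to be measurable;
    for the covering radius, a supremum over the cube, this comes from a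
    countable dense set of centers ([covering_gt_grid]). *)

(** * Averages over finite types *)

Section Mean.
Variables (R : realFieldType) (T : finType).
Implicit Types (F G : T -> R).

Definition mean F : R := #|T|%:R^-1 * \sum_x F x.

Lemma eq_mean F G : F =1 G -> mean F = mean G.
Proof. by move=> FG; congr (_ * _); apply: eq_bigr. Qed.

Lemma ler_mean F G : (forall x, F x <= G x) -> mean F <= mean G.
Proof. by move=> FG; rewrite ler_wpM2l ?invr_ge0//; apply: ler_sum. Qed.

Lemma mean_ge0 F : (forall x, 0 <= F x) -> 0 <= mean F.
Proof. by move=> F0; rewrite mulr_ge0 ?invr_ge0// sumr_ge0. Qed.

Lemma meanZ c F : mean (fun x => c * F x) = c * mean F.
Proof. by rewrite /mean -mulr_sumr mulrCA. Qed.

Lemma meanD F G : mean (fun x => F x + G x) = mean F + mean G.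
Proof. by rewrite /mean big_split mulrDr. Qed.

Lemma meanB F G : mean (fun x => F x - G x) = mean F - mean G.
Proof. by rewrite /mean sumrB mulrBr. Qed.

Lemma mean_sum (I : Type) (s : seq I) (p : pred I) (F : I -> T -> R) :
  mean (fun x => \sum_(i <- s | p i) F i x) = \sum_(i <- s | p i) mean (F i).
Proof. by rewrite /mean exchange_big /= mulr_sumr. Qed.

Lemma mean_cst (x0 : T) c : mean (fun=> c) = c.
Proof.
rewrite /mean sumr_const -[c *+ _]mulr_natl mulKf// pnatr_eq0 -lt0n.
by apply/card_gt0P; exists x0.
Qed.

Lemma mean_reindex (h : T -> T) F : injective h -> mean (fun x => F (h x)) = mean F.
Proof. by move=> hI; congr (_ * _); rewrite [RHS](reindex_inj hI). Qed.

End Mean.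

(** The coordinates of a uniform function are independent and uniform. *)
Lemma mean_prod (R : realFieldType) (I T : finType) (F : I -> T -> R) :
  mean (fun f : {ffun I -> T} => \prod_i F i (f i)) = \prod_i mean (F i).
Proof.
rewrite /mean -bigA_distr_bigA /= big_split /= card_ffun prodr_const.
by rewrite natrX exprVn.
Qed.

(** * Revealing the values of uniform permutations *)

Section Reveal.
Variables (R : realFieldType) (N : nat).
Implicit Types (D : {set 'I_N}) (x y : 'I_N) (s t : 'S_N).

Definition determined_on D (F : 'S_N -> R) :=
  forall s t, {in D, s =1 t} -> F s = F t.

Lemma tperm_outside D x y s : x \notin D -> y \notin D ->
  {in D, (tperm x y * s)%g =1 s}.
Proof.
move=> xD yD z zD; rewrite permM tpermD //.
  by apply: contraNneq xD => ->.
by apply: contraNneq yD => ->.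
Qed.

(** The law of the permutation is invariant by exchanging the images of two
    points outside [D], an operation that [F] does not notice: hence the image of
    [x] may be replaced by that of each point outside [D] in turn. *)
Lemma mean_reveal D x (F : 'I_N -> 'S_N -> R) :
    x \notin D -> (forall a, determined_on D (F a)) ->
  (#|~: D|)%:R * mean (fun s : 'S_N => F (s x) s) =
  mean (fun s : 'S_N => \sum_(y in ~: D) F (s y) s).
Proof.
move=> xD Fsees; rewrite mean_sum mulr_natl -sumr_const.
apply: eq_bigr => y; rewrite inE => yD.
rewrite -(mean_reindex _ (mulgI (tperm x y))); apply: eq_mean => s.
by rewrite permM tpermL; apply/Fsees/tperm_outside.
Qed.

End Reveal.

Section RevealFamily.
Variables (R : realFieldType) (d N : nat).
Local Notation W := {ffun 'I_d -> 'S_N}.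
Implicit Types (D : {set 'I_N}) (r : W).

Definition family_determined D (F : W -> R) :=
  forall r r', (forall j, {in D, r j =1 r' j}) -> F r = F r'.

(** The same exchange made independently in each permutation of the family. *)
Lemma mean_reveal_family D x (F : W -> R) (g : 'I_d -> 'I_N -> R) :
    x \notin D -> family_determined D F ->
  (#|~: D|)%:R ^+ d * mean (fun r => F r * \prod_j g j (r j x)) =
  mean (fun r => F r * \prod_j \sum_(y in ~: D) g j (r j y)).
Proof.
move=> xD Fsees.
under [RHS]eq_mean do rewrite bigA_distr_big mulr_sumr.
rewrite mean_sum /=.
have -> : (#|~: D|)%:R ^+ d =
    #|(ffun_on (mem (~: D)) : {pred {ffun 'I_d -> 'I_N}})|%:R :> R.
  by rewrite card_ffun_on card_ord natrX.
rewrite mulr_natl -sumr_const; apply: eq_bigr => f /ffun_onP fD.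
pose h (r : W) : W := [ffun j => (tperm x (f j) * r j)%g].
have h_inj : injective h.
  move=> r r' /ffunP e; apply/ffunP => j; have := e j; rewrite !ffunE.
  exact: mulgI.
rewrite -(mean_reindex _ h_inj) /=; apply: eq_mean => r; congr (_ * _).
  apply: Fsees => j; rewrite ffunE; apply: tperm_outside => //.
  by have := fD j; rewrite inE.
by apply: eq_bigr => j _; rewrite ffunE permM tpermL.
Qed.

End RevealFamily.

(** * Runs of revealed indices *)

Lemma disjointsU1r (T : finType) (s : seq T) v (D : {set T}) :
  [disjoint s & v |: D] = (v \notin s) && [disjoint s & D].
Proof.
rewrite disjoint_sym [in RHS]disjoint_sym -disjointU1.
by apply: eq_disjoint => x; rewrite !inE.
Qed.

Section Runs.
Variables (R : realFieldType) (d N : nat) (j0 : 'I_d).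
Local Notation W := {ffun 'I_d -> 'S_N}.
Implicit Types (D : {set 'I_N}) (r : W) (B : 'I_d -> {set 'I_N}).
Implicit Types (F : W -> R) (s : seq 'I_N).

(** The coordinate [j0] is left out: once the points are listed by their
    coordinate [j0], the index [v] itself is that coordinate. *)
Definition hits B r (v : 'I_N) := [forall (j | j != j0), r j v \in B j].

Lemma hitsE B r v :
  (hits B r v)%:R = \prod_j (if j == j0 then 1 else (r j v \in B j)%:R) :> R.
Proof.
rewrite (bigD1 j0)//= eqxx mul1r.
case: (boolP (hits _ _ _)) => [/forall_inP h|].
  by rewrite big1// => j jj0; rewrite (negbTE jj0) h.
rewrite negb_forall => /existsP[j]; rewrite negb_imply => /andP[jj0 hj].
by rewrite (bigD1 j)//= (negbTE jj0) (negbTE hj) mul0r.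
Qed.

Lemma sum_hits_out D B r j : \sum_(y in ~: D) (r j y \in B j)%:R =
  #|preimset (r j) (mem (B j)) :\: D|%:R :> R.
Proof.
rewrite -natr_sum -sum1_card big_mkcond [in RHS]big_mkcond; congr (_%:R).
by apply: eq_bigr => y _; rewrite !inE; case: (y \in D); case: (_ \in B j).
Qed.

Lemma card_hits_le D B r j : (#|preimset (r j) (mem (B j)) :\: D| <= #|B j|)%N.
Proof.
by rewrite -[leqRHS](card_preimset (B j) (@perm_inj _ (r j))) subset_leq_card ?finset.subsetDl.
Qed.

Lemma card_hits_ge D B r j :
  (#|B j| - #|D| <= #|preimset (r j) (mem (B j)) :\: D|)%N.
Proof.
rewrite -[X in (X - _)%N](card_preimset (B j) (@perm_inj _ (r j))) cardsD leq_sub2l//.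
by rewrite subset_leq_card ?finset.subsetIr.
Qed.

(** Revealing the images of [v]: for each [j] there remain as many favourable
    choices as there are points outside [D] sent into [B j]. *)
Lemma mean_hitsE D B v F : v \notin D -> family_determined D F ->
  #|~: D|%:R ^+ d.-1 * mean (fun r => F r * (hits B r v)%:R) =
  mean (fun r => F r * \prod_(j | j != j0) #|preimset (r j) (mem (B j)) :\: D|%:R).
Proof.
move=> vD Fs.
have n0 : #|~: D|%:R != 0 :> R.
  by rewrite pnatr_eq0 -lt0n; apply/card_gt0P; exists v; rewrite inE.
apply: (mulfI n0); rewrite mulrA -exprS prednK; last by case: (d) j0 => [[]|].
pose g j y : R := if j == j0 then 1 else (y \in B j)%:R.
under eq_mean do rewrite hitsE.
rewrite (mean_reveal_family g vD Fs) -meanZ; apply: eq_mean => r.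
rewrite mulrCA; congr (_ * _).
rewrite (bigD1 j0)//=; congr (_ * _).
  by rewrite /g eqxx sumr_const.
by apply: eq_bigr => j jj0; rewrite /g (negbTE jj0) sum_hits_out.
Qed.

Lemma prod_nat_le (f : 'I_d -> nat) c : (forall j, f j <= c)%N ->
  \prod_(j | j != j0) (f j)%:R <= c%:R ^+ d.-1 :> R.
Proof.
move=> fc; have <- : #|predC1 j0| = d.-1 by rewrite cardC1 card_ord.
rewrite -prodr_const.
by apply: ler_prod => j _; rewrite ler0n ler_nat fc.
Qed.

Lemma prod_nat_ge (f : 'I_d -> nat) c : (forall j, c <= f j)%N ->
  c%:R ^+ d.-1 <= \prod_(j | j != j0) (f j)%:R :> R.
Proof.
move=> fc; have <- : #|predC1 j0| = d.-1 by rewrite cardC1 card_ord.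
rewrite -prodr_const.
by apply: ler_prod => j _; rewrite ler0n ler_nat fc.
Qed.

(** At least [m] values are still free, at most [c] of them are in a side of
    the box: a conditional probability of at most [(c / m) ^ (d - 1)]. *)
Lemma mean_hits_le D B v F (b : R) m c : v \notin D -> family_determined D F ->
    (forall r, 0 <= F r) -> (forall j, #|B j| <= c)%N -> (0 < m)%N ->
    (#|D| + m <= N)%N -> c%:R ^+ d.-1 <= b * m%:R ^+ d.-1 ->
  mean (fun r => F r * (hits B r v)%:R) <= b * mean F.
Proof.
move=> vD Fs F0 Bc m0 Dm cb.
have mp : 0 < m%:R ^+ d.-1 :> R by rewrite exprn_gt0// ltr0n.
rewrite -(ler_pM2l mp) [leRHS]mulrA [_ * b]mulrC.
apply: (@le_trans _ _ (c%:R ^+ d.-1 * mean F)); last first.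
  by rewrite ler_wpM2r// mean_ge0.
apply: (@le_trans _ _
    (#|~: D|%:R ^+ d.-1 * mean (fun r => F r * (hits B r v)%:R))).
  rewrite ler_wpM2r//; first by apply: mean_ge0 => r; rewrite mulr_ge0.
  by rewrite lerXn2r ?nnegrE// ler_nat cardsCs finset.setCK card_ord; lia.
rewrite mean_hitsE// -meanZ ler_mean// => r; rewrite mulrC ler_wpM2r//.
by apply: prod_nat_le => j; apply: leq_trans (card_hits_le _ _ _ _) _.
Qed.

(** At most [N] values are free, at least [m] of them are in a side of the box,
    since the points of [D] use up at most [#|D|]. *)
Lemma mean_hits_ge D B v F (b : R) m : v \notin D -> family_determined D F ->
    (forall r, 0 <= F r) -> (forall j, #|D| + m <= #|B j|)%N ->
    b * N%:R ^+ d.-1 <= m%:R ^+ d.-1 ->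
  b * mean F <= mean (fun r => F r * (hits B r v)%:R).
Proof.
move=> vD Fs F0 Bm bm.
have Np : 0 < N%:R ^+ d.-1 :> R.
  by rewrite exprn_gt0// ltr0n; case: (N) v {vD} => [[]|].
rewrite -(ler_pM2l Np) [leLHS]mulrA [_ * b]mulrC.
apply: (@le_trans _ _ (m%:R ^+ d.-1 * mean F)).
  by rewrite ler_wpM2r// mean_ge0.
apply: (@le_trans _ _
    (#|~: D|%:R ^+ d.-1 * mean (fun r => F r * (hits B r v)%:R))); last first.
  rewrite ler_wpM2r//; first by apply: mean_ge0 => r; rewrite mulr_ge0.
  by rewrite lerXn2r ?nnegrE// ler_nat -[leqRHS]card_ord max_card.
rewrite mean_hitsE// -meanZ ler_mean// => r; rewrite mulrC ler_wpM2l//.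
apply: prod_nat_ge => j; apply: leq_trans (card_hits_ge _ _ _ _).
by have := Bm j; lia.
Qed.

Definition missed B r s := all (fun v => ~~ hits B r v) s.

Lemma family_determined_hits B v (D : {set 'I_N}) (F : W -> R) : family_determined D F ->
  family_determined (v |: D) (fun r => F r * (~~ hits B r v)%:R).
Proof.
move=> Fs r r' e; congr (_ * (~~ _)%:R).
  by apply: Fs => j x xD; apply: e; rewrite inE xD orbT.
by apply: eq_forallb => j; rewrite e// finset.setU11.
Qed.

Lemma mean_missed_rec B v s F :
  mean (fun r => F r * (missed B r (v :: s))%:R) =
  mean (fun r => F r * (~~ hits B r v)%:R * (missed B r s)%:R).
Proof. by apply: eq_mean => r; rewrite /= -mulnb natrM mulrA. Qed.

Lemma mean_unhit B v F : mean (fun r => F r * (~~ hits B r v)%:R) =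
  mean F - mean (fun r => F r * (hits B r v)%:R).
Proof.
rewrite -meanB; apply: eq_mean => r.
by case: (hits B r v); rewrite !(mulr1, mulr0) ?subrr ?subr0.
Qed.

(** Iterating [mean_hits_le]: each index of [s] misses the box with conditional
    probability at least [1 - b], whatever the past [D]. *)
Lemma mean_missed_ge B s D F (b : R) m c : uniq s -> [disjoint s & D] ->
    family_determined D F -> (forall r, 0 <= F r) -> (forall j, #|B j| <= c)%N ->
    (0 < m)%N -> (#|D| + size s + m <= N)%N ->
    b <= 1 -> c%:R ^+ d.-1 <= b * m%:R ^+ d.-1 ->
  (1 - b) ^+ size s * mean F <= mean (fun r => F r * (missed B r s)%:R).
Proof.
move=> + + + + Bc m0 + b1 cb.
elim: s D F => [|v s IH] D F.
  move=> _ _ _ _ _; rewrite expr0 mul1r ler_mean// => r; by rewrite mulr1.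
rewrite disjoint_cons [uniq _]/= => /andP[vs us] /andP[vD sD] Fs F0 Dm.
rewrite mean_missed_rec.
have Fs' := @family_determined_hits B v _ _ Fs.
have vsD : [disjoint s & v |: D] by rewrite disjointsU1r vs.
have F0' r : 0 <= F r * (~~ hits B r v)%:R by rewrite mulr_ge0.
have Dm' : (#|v |: D| + size s + m <= N)%N.
  by rewrite cardsU1 vD; move: Dm; rewrite /= addnS add1n !addSn.
apply: le_trans (IH _ _ us vsD Fs' F0' Dm').
rewrite /= exprSr -mulrA ler_wpM2l ?exprn_ge0 ?subr_ge0//.
rewrite mean_unhit mulrBl mul1r lerB//.
by apply: (mean_hits_le (m := m) vD Fs F0 Bc) => //; move: Dm => /=; lia.
Qed.

(** Iterating [mean_hits_ge]; the bound requires that the sides of the box are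
    not exhausted by the past [D] and the run [s]. *)
Lemma mean_missed_le B s D F (b : R) m : uniq s -> [disjoint s & D] ->
    family_determined D F -> (forall r, 0 <= F r) ->
    (forall j, #|D| + size s + m <= #|B j|)%N ->
    b <= 1 -> b * N%:R ^+ d.-1 <= m%:R ^+ d.-1 ->
  mean (fun r => F r * (missed B r s)%:R) <= (1 - b) ^+ size s * mean F.
Proof.
move=> + + + + + b1 bm.
elim: s D F => [|v s IH] D F.
  move=> _ _ _ _ _; rewrite expr0 mul1r ler_mean// => r; by rewrite mulr1.
rewrite disjoint_cons [uniq _]/= => /andP[vs us] /andP[vD sD] Fs F0 Dm.
rewrite mean_missed_rec.
have Fs' := @family_determined_hits B v _ _ Fs.
have vsD : [disjoint s & v |: D] by rewrite disjointsU1r vs.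
have F0' r : 0 <= F r * (~~ hits B r v)%:R by rewrite mulr_ge0.
have Dm' j : (#|v |: D| + size s + m <= #|B j|)%N.
  by rewrite cardsU1 vD; have := Dm j; rewrite /= addnS add1n !addSn.
apply: le_trans (IH _ _ us vsD Fs' F0' Dm') _.
rewrite /= exprSr -mulrA ler_wpM2l ?exprn_ge0 ?subr_ge0//.
rewrite mean_unhit mulrBl mul1r lerB//.
by apply: (mean_hits_ge (m := m) vD Fs F0) => // j; have := Dm j => /=; lia.
Qed.
End Runs.

(** * Boxes hit by the sample *)

Section Boxes.
Variables (R : realFieldType) (d N : nat) (j0 : 'I_d).
Local Notation W := {ffun 'I_d -> 'S_N}.
Implicit Types (r : W) (B : 'I_d -> {set 'I_N}).

Definition box_hit B r := [exists i, [forall j, r j i \in B j]].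

(** The change of variables that lists the points by their coordinate [j0]: if
    [r] is uniform then so is [relabel r], and the point of [relabel r] whose
    coordinate [j0] is [v] has coordinates [r j v] for [j != j0]. *)
Definition relabel r : W :=
  [ffun j => if j == j0 then r j0 else (r j0 * r j)%g].

Lemma relabel_inj : injective relabel.
Proof.
move=> r r' /ffunP e; have e0 := e j0; rewrite !ffunE eqxx in e0.
apply/ffunP => j; have := e j; rewrite !ffunE.
by case: eqP => [->//|_]; rewrite e0; apply: mulgI.
Qed.

Lemma box_hit_relabel B r :
  box_hit B (relabel r) = ~~ missed j0 B r (enum (B j0)).
Proof.
rewrite -has_predC; apply/existsP/hasP => [[i /forallP h]|[v vB]].
  exists (r j0 i); first by have := h j0; rewrite ffunE eqxx mem_enum.
  apply/negPn/forall_inP => j jj0; have := h j.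
  by rewrite ffunE (negbTE jj0) permM.
rewrite mem_enum in vB; rewrite /= negbK => /forall_inP h.
exists ((r j0)^-1%g v); apply/forallP => j; rewrite ffunE.
by case: eqP => [->|/eqP/h]; rewrite ?permM permKV.
Qed.

Lemma mean_relabel (F : W -> R) : mean F = mean (fun r => F (relabel r)).
Proof. by rewrite (mean_reindex _ relabel_inj). Qed.

(** Only [m] indices of the side [j0] are revealed, so that at least [m] of
    the values of each side always remain free. *)
Lemma mean_box_missed_le B m (b : R) : (forall j, m + m <= #|B j|)%N ->
    b <= 1 -> b * N%:R ^+ d.-1 <= m%:R ^+ d.-1 ->
  mean (fun r => (~~ box_hit B r)%:R) <= (1 - b) ^+ m.
Proof.
move=> Bm b1 bm; rewrite mean_relabel.
have sz : size (take m (enum (B j0))) = m.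
  by rewrite size_takel// -cardE (leq_trans _ (Bm j0))// leq_addr.
have := @mean_missed_le R d N j0 B (take m (enum (B j0))) finset.set0 (fun=> 1) b m.
rewrite sz (mean_cst [ffun=> 1%g]) mulr1 cards0 => /(_ _ _ _ _ _ b1 bm) h.
apply: le_trans (h _ _ _ _ _) => //.
- apply: ler_mean => r; rewrite box_hit_relabel negbK mul1r.
  case: (boolP (missed _ _ _ (enum _))) => // h'.
  suff -> : missed j0 B r (take m (enum (B j0))) by [].
  by apply/allP => v /mem_take /(allP h').
- by rewrite take_uniq// enum_uniq.
- by rewrite disjoint_has; apply/hasPn => v _; rewrite !inE.
Qed.

Lemma family_determined_missed B s (D D' : {set 'I_N}) (F : W -> R) : family_determined D F ->
  D \subset D' -> {subset s <= D'} ->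
  family_determined D' (fun r => F r * (~~ missed j0 B r s)%:R).
Proof.
move=> Fs DD' sD' r r' e; congr (_ * (~~ _)%:R).
  by apply: Fs => j x xD; apply: e; apply: (fintype.subsetP DD').
by apply: eq_in_all => v vs; congr (~~ _); apply: eq_forallb => j; rewrite e// sD'.
Qed.

(** Boxes with pairwise disjoint sides are processed one after the other: each is
    missed with conditional probability at least [(1 - b) ^ l] given the
    previous ones, as long as [m] values remain free in each coordinate. *)
Lemma mean_all_hit_le (B : nat -> {set 'I_N}) M l m (b : R) :
    (forall k k', k != k' -> [disjoint B k & B k']) ->
    (forall k, (k < M)%N -> #|B k| = l) -> (0 < m)%N -> (M * l + m <= N)%N ->
    0 <= b <= 1 -> l%:R ^+ d.-1 <= b * m%:R ^+ d.-1 ->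
  mean (fun r => [forall k : 'I_M, box_hit (fun=> B k) r]%:R) <=
    (1 - (1 - b) ^+ l) ^+ M.
Proof.
move=> dis cB m0 MN /andP[b0 b1] lb; rewrite mean_relabel.
have q1 : 0 <= 1 - (1 - b) ^+ l.
  by rewrite subr_ge0 exprn_ile1// ?subr_ge0// gerBl.
pose F K r : R := \prod_(k < K) (~~ missed j0 (fun=> B k) r (enum (B k)))%:R.
have FM r : [forall k : 'I_M, box_hit (fun=> B k) (relabel r)]%:R <= F M r.
  case: forallP => [h|_]; last by rewrite prodr_ge0.
  by rewrite /F big1// => k _; rewrite -box_hit_relabel h.
apply: le_trans (ler_mean FM) _.
(* the strengthened induction also records what the first boxes reveal *)
suff [] : family_determined [set v | [exists k : 'I_M, v \in B k]] (F M) /\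
    mean (F M) <= (1 - (1 - b) ^+ l) ^+ M by [].
have : (M <= M)%N by []; elim: {-2}M => [_|K IH KM].
  split; first by move=> r r' _; rewrite /F !big_ord0.
  by rewrite expr0 /F (eq_mean (G := fun=> 1)) ?(mean_cst [ffun=> 1%g])// => r; rewrite big_ord0.
have [Fs FK] := IH (ltnW KM).
have FS r : F K.+1 r = F K r * (~~ missed j0 (fun=> B K) r (enum (B K)))%:R.
  by rewrite /F big_ord_recr.
split.
  suff H : family_determined [set v | [exists k : 'I_K.+1, v \in B k]]
      (fun r => F K r * (~~ missed j0 (fun=> B K) r (enum (B K)))%:R).
    by move=> r r' /H; rewrite !FS.
  apply: (family_determined_missed _ Fs).
    apply/fintype.subsetP => v; rewrite !inE => /existsP[k vk].
    by apply/existsP; exists (widen_ord (leqnSn K) k).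
  by move=> v; rewrite mem_enum inE => vK; apply/existsP; exists ord_max.
rewrite (eq_mean FS).
have -> : mean (fun r => F K r * (~~ missed j0 (fun=> B K) r (enum (B K)))%:R)
    = mean (F K) - mean (fun r => F K r * (missed j0 (fun=> B K) r (enum (B K)))%:R).
  rewrite -meanB; apply: eq_mean => r.
  by case: missed; rewrite !(mulr1, mulr0) ?subrr ?subr0.
have D0 : (#|[set v | [exists k : 'I_K, v \in B k]]| <= K * l)%N.
  have -> : [set v | [exists k : 'I_K, v \in B k]] = \bigcup_(k < K) B k.
    apply/setP => v; rewrite inE; apply/existsP/finset.bigcupP => [[k vk]|[k _ vk]];
    by exists k.
  rewrite -[K in (K * _)%N]card_ord -sum_nat_const.
  elim/big_rec2: _ => [|k n A _ h]; first by rewrite cards0.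
  rewrite (leq_trans (leq_card_setU _ _))// leq_add// cB//.
  exact: ltn_trans (ltn_ord k) KM.
have := @mean_missed_ge R d N j0 (fun=> B K) (enum (B K)) _ (F K) b m l
  (enum_uniq _) _ Fs.
rewrite -cardE cB// => h.
have {}h : (1 - b) ^+ l * mean (F K) <=
    mean (fun r => F K r * (missed j0 (fun=> B K) r (enum (B K)))%:R).
  apply: h => //.
  - rewrite disjoint_has; apply/hasPn => v; rewrite mem_enum inE => vK.
    apply/existsP => -[k vk].
    have /dis/disjointFr/(_ vk) : k != K :> nat by rewrite neq_ltn ltn_ord.
    by rewrite vK.
  - by move=> r; rewrite prodr_ge0.
  - apply: leq_trans MN; rewrite leq_add2r; apply: leq_trans (leq_mul KM (leqnn l)).
    by rewrite mulSn addnC leq_add2l.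
rewrite exprS; apply: le_trans (ler_wpM2l q1 FK).
by rewrite mulrBl mul1r lerB.
Qed.
End Boxes.

(** * Close pairs: probabilities for one permutation *)

Section Pairs.
Variables (R : realFieldType) (N : nat) (s : rel 'I_N).
Hypotheses (s_sym : symmetric s) (s_irr : irreflexive s).
Implicit Types i k l n a b : 'I_N.

Definition deg a : R := \sum_b (s a b)%:R.

(** For an irreflexive [s], the probability that two given points are sent to
    related values, see [mean_near]. *)
Definition near_prob : R := (\sum_a deg a) / (N%:R * N.-1%:R).

Lemma mean_deg i : N%:R * mean (fun t : 'S_N => deg (t i)) = \sum_a deg a.
Proof.
have := @mean_reveal R N finset.set0 i (fun a _ => deg a).
rewrite finset.setC0 cardsT card_ord => ->//; last by rewrite inE.
rewrite -[RHS](@mean_cst _ _ (1%g : 'S_N)); apply: eq_mean => t.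
rewrite [RHS](reindex_inj (@perm_inj _ t)).
by apply: eq_bigl => y; rewrite inE.
Qed.

Lemma mean_near i k : i != k ->
  mean (fun t : 'S_N => (s (t i) (t k))%:R) = near_prob.
Proof.
move=> ik.
have := @mean_reveal R N [set i] k (fun a t => (s (t i) a)%:R).
rewrite cardsC1 card_ord inE eq_sym ik => h.
have {h} : N.-1%:R * mean (fun t : 'S_N => (s (t i) (t k))%:R) =
    mean (fun t : 'S_N => deg (t i)).
  rewrite h//; last by move=> a t t' e; rewrite e// set11.
  apply: eq_mean => t; rewrite /deg [RHS](reindex_inj (@perm_inj _ t)).
  rewrite [RHS](bigD1 i)//= s_irr add0r; apply: eq_bigl => y.
  by rewrite !inE.
have N1 : (1 < N)%N.
  have := max_card (mem [set i; k]); rewrite card_ord cards2 ik; lia.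
rewrite /near_prob -(mean_deg i) => <-.
rewrite mulrA mulrAC divff ?mul1r// mulf_neq0//; rewrite pnatr_eq0; lia.
Qed.

Lemma sum_near_le (t : 'S_N) i (D : {set 'I_N}) :
  \sum_(y in ~: D) (s (t i) (t y))%:R <= deg (t i).
Proof.
rewrite /deg [leRHS](reindex_inj (@perm_inj _ t)) /= [leRHS](bigID (mem (~: D)))/=.
by rewrite lerDl sumr_ge0.
Qed.

(** Two pairs sharing a point: given that [k] is close to [i], the point [n] has
    at most [M] favourable values among [N - 2]. *)
Lemma mean_near_fork_le M i k n : (forall a, deg a <= M) ->
    i != k -> i != n -> k != n ->
  N.-2%:R * mean (fun t : 'S_N => (s (t i) (t k) && s (t i) (t n))%:R)
    <= M * near_prob.
Proof.
move=> dM ik i_n kn; rewrite -(mean_near ik) -[leRHS]meanZ.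
have := @mean_reveal R N [set i; k] n
  (fun a t => (s (t i) (t k) && s (t i) a)%:R).
rewrite cardsCs finset.setCK card_ord cards2 ik !inE negb_or ![n == _]eq_sym i_n kn.
rewrite subn2 => H; rewrite [leLHS]H//; last first.
  by move=> a t t' e; rewrite !e// !inE eqxx ?orbT.
apply: ler_mean => t.
rewrite (eq_bigr (fun y => (s (t i) (t k))%:R * (s (t i) (t y))%:R)).
  rewrite -mulr_sumr mulrC ler_wpM2r//.
  by apply: le_trans (sum_near_le _ _ _) _.
by move=> y _; rewrite -natrM mulnb.
Qed.

(** Disjoint pairs are almost independent: the images of [n] and then of [l] are
    averaged, and forgetting that values are already taken only increases the
    number of favourable choices. *)
Lemma mean_near2_le i k l n : uniq [:: i; k; l; n] ->
  N.-2%:R * N.-2.-1%:R *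
    mean (fun t : 'S_N => (s (t i) (t k) && s (t l) (t n))%:R)
    <= N%:R * N.-1%:R * near_prob ^+ 2.
Proof.
rewrite /= !inE !negb_or !andbT => /and3P[/and3P[ik il i_n] /andP[kl kn] ln].
have N1 : (1 < N)%N.
  have := max_card (mem [set i; k]); rewrite card_ord cards2 ik; lia.
have e : N%:R * N.-1%:R * near_prob = \sum_a deg a.
  rewrite /near_prob mulrC divfK// mulf_neq0//; rewrite pnatr_eq0; lia.
rewrite expr2 mulrA e -[leLHS]mulrA.
have := @mean_reveal R N (l |: [set i; k]) n
  (fun a t => (s (t i) (t k) && s (t l) a)%:R).
rewrite cardsCs finset.setCK card_ord cardsU1 cards2 ik !inE !negb_or.
rewrite ![l == _]eq_sym ![n == _]eq_sym il kl ln i_n kn (_ : (N - _)%N = N.-2.-1); last by rewrite /=; lia.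
move=> H; rewrite [X in _ * X]H//; last first.
  by move=> a t t' h; rewrite !h// !inE eqxx ?orbT.
have h2 : N.-2%:R * mean (fun t : 'S_N => (s (t i) (t k))%:R * deg (t l))
    <= (\sum_a deg a) * near_prob.
  rewrite -(mean_near ik) -[leRHS]meanZ.
  have := @mean_reveal R N [set i; k] l
    (fun a t => (s (t i) (t k))%:R * deg a).
  rewrite cardsCs finset.setCK card_ord cards2 ik !inE negb_or ![l == _]eq_sym il kl.
  rewrite subn2 => H'; rewrite [leLHS]H'//; last first.
    by move=> a t t' e'; rewrite !e'// !inE eqxx ?orbT.
  apply: ler_mean => t; rewrite -mulr_sumr mulrC ler_wpM2r//.
  rewrite [leRHS](reindex_inj (@perm_inj _ t)) [leRHS](bigID (mem (~: [set i; k])))/=.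
  by rewrite lerDl sumr_ge0// => a _; rewrite sumr_ge0.
apply: le_trans h2; rewrite ler_wpM2l//; apply: ler_mean => t.
rewrite (eq_bigr (fun y => (s (t i) (t k))%:R * (s (t l) (t y))%:R)).
  by rewrite -mulr_sumr ler_wpM2l// sum_near_le.
by move=> y _; rewrite -natrM mulnb.
Qed.

End Pairs.

(** * Close pairs: the second moment method *)

Section SecondMoment.
Variables (R : realFieldType) (d N : nat) (s : rel 'I_N).
Hypotheses (s_sym : symmetric s) (s_irr : irreflexive s).
Local Notation W := {ffun 'I_d -> 'S_N}.
Implicit Types (r : W) (i k l n : 'I_N) (A B : {set 'I_N}).
Variables (p3 p4 : R).
Hypotheses (p3_ge0 : 0 <= p3) (p4_ge0 : 0 <= p4).
Hypothesis p3P : forall i k n, i != k -> i != n -> k != n ->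
  mean (fun t : 'S_N => (s (t i) (t k) && s (t i) (t n))%:R) <= p3.
Hypothesis p4P : forall i k l n, uniq [:: i; k; l; n] ->
  mean (fun t : 'S_N => (s (t i) (t k) && s (t l) (t n))%:R) <= p4.
Local Notation p := (near_prob R s).

Definition near_all r i k := [forall j, s (r j i) (r j k)].

Lemma forall_prodE (b : 'I_d -> bool) :
  [forall j, b j]%:R = \prod_j (b j)%:R :> R.
Proof.
case: forallP => [h|/forallP]; first by rewrite big1// => j _; rewrite h.
by rewrite negb_forall => /existsP[j /negbTE bj]; rewrite (bigD1 j)//= bj mul0r.
Qed.

Lemma mean_near_all i k : i != k ->
  mean (fun r => (near_all r i k)%:R) = p ^+ d.
Proof.
move=> ik; under eq_mean do rewrite forall_prodE.
rewrite (mean_prod (fun _ (t : 'S_N) => (s (t i) (t k))%:R)).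
by rewrite prodr_const card_ord mean_near.
Qed.

Lemma mean_near_all2 i k l n :
  mean (fun r => (near_all r i k && near_all r l n)%:R) =
  mean (fun t : 'S_N => (s (t i) (t k) && s (t l) (t n))%:R) ^+ d :> R.
Proof.
rewrite -[d in RHS]card_ord -prodr_const -mean_prod; apply: eq_mean => r.
by rewrite -mulnb natrM !forall_prodE -big_split; apply: eq_bigr => j _;
  rewrite /= -natrM mulnb.
Qed.

(** Disjointness of [A] and [B] leaves four cases for two pairs: equal, sharing
    the point of [A], sharing the point of [B], or disjoint. *)
Lemma near_all_cross_le A B i k i' k' : [disjoint A & B] ->
    i \in A -> i' \in A -> k \in B -> k' \in B ->
  mean (fun r => (near_all r i k && near_all r i' k')%:R) <=
    p4 ^+ d + (i == i')%:R * p3 ^+ d + (k == k')%:R * p3 ^+ d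
    + ((i == i') && (k == k'))%:R * p ^+ d.
Proof.
move=> AB iA i'A kB k'B.
have ne a b : a \in A -> b \in B -> a != b.
  by move=> aA bB; apply: contraTneq aA => ->; rewrite (disjointFl AB bB).
have mge0 (b : 'S_N -> bool) : 0 <= mean (fun t => (b t)%:R) :> R.
  by apply: mean_ge0.
have p0 : 0 <= p ^+ d.
  by rewrite exprn_ge0// mulr_ge0 ?invr_ge0 ?mulr_ge0// sumr_ge0// => a _;
    apply: sumr_ge0.
have [p30 p40] : 0 <= p3 ^+ d /\ 0 <= p4 ^+ d by split; apply: exprn_ge0.
have [<-{i' i'A}|ii'] := eqVneq i i'; have [<-{k' k'B}|kk'] := eqVneq k k';
  rewrite /= ?mul1r ?mul0r ?addr0.
- under eq_mean do rewrite andbb.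
  by rewrite (mean_near_all (ne _ _ iA kB)) lerDr !addr_ge0.
- rewrite mean_near_all2 (@le_trans _ _ (p3 ^+ d))// ?lerDr//.
  by rewrite lerXn2r ?nnegrE// p3P// ne.
- rewrite mean_near_all2 (@le_trans _ _ (p3 ^+ d))// ?lerDr//.
  rewrite lerXn2r ?nnegrE//; have ki : k != i by rewrite eq_sym ne.
  have ki' : k != i' by rewrite eq_sym ne.
  apply: le_trans (p3P ki ki' ii'); rewrite le_eqVlt; apply/orP; left.
  by apply/eqP/eq_mean => t; rewrite ![s (t k) _]s_sym.
- rewrite mean_near_all2 lerXn2r ?nnegrE// p4P//=.
  by rewrite !inE !negb_or ii' kk' (ne i k)// (ne i k')// (ne i' k')// eq_sym ne.
Qed.

(** Chebyshev's inequality for the number [Y] of close pairs in [A * B]: when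
    there is none, [(Y - E) ^ 2] is the square of the mean [E].  Taking the pairs
    in a product of disjoint sets keeps the cross terms few. *)
Lemma second_moment A B (a b : R) : [disjoint A & B] ->
    a = #|A|%:R -> b = #|B|%:R ->
  mean (fun r => (~~ [exists i in A, exists k in B, near_all r i k])%:R)
    * (a * b * p ^+ d) ^+ 2 <=
  a * b * (a * b * p4 ^+ d + b * p3 ^+ d + a * p3 ^+ d + p ^+ d)
  - (a * b * p ^+ d) ^+ 2.
Proof.
move=> AB aE bE.
have ne i k : i \in A -> k \in B -> i != k.
  by move=> iA kB; apply: contraTneq iA => ->; rewrite (disjointFl AB kB).
pose Y r : R := \sum_(i in A) \sum_(k in B) (near_all r i k)%:R.
set E := a * b * p ^+ d.
have EY : mean Y = E.
  rewrite mean_sum (eq_bigr (fun=> b * p ^+ d)); last first.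
    move=> i iA; rewrite mean_sum (eq_bigr (fun=> p ^+ d)).
      by rewrite sumr_const bE mulr_natl.
    by move=> k kB; rewrite mean_near_all// ne.
  by rewrite sumr_const -[_ *+ _]mulr_natl -aE mulrA.
have EY2 : mean (fun r => Y r ^+ 2) <=
    a * b * (a * b * p4 ^+ d + b * p3 ^+ d + a * p3 ^+ d + p ^+ d).
  pose c i k i' k' := p4 ^+ d + (i == i')%:R * p3 ^+ d + (k == k')%:R * p3 ^+ d
    + ((i == i') && (k == k'))%:R * p ^+ d.
  have -> : mean (fun r => Y r ^+ 2) = \sum_(i in A) \sum_(k in B)
      \sum_(i' in A) \sum_(k' in B)
      mean (fun r => (near_all r i k && near_all r i' k')%:R).
    under eq_mean do rewrite expr2 {1}/Y mulr_suml.
    rewrite mean_sum; apply: eq_bigr => i _.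
    under eq_mean do rewrite mulr_suml.
    rewrite mean_sum; apply: eq_bigr => k _.
    under eq_mean do rewrite mulr_sumr.
    rewrite mean_sum; apply: eq_bigr => i' _.
    under eq_mean do rewrite mulr_sumr.
    rewrite mean_sum; apply: eq_bigr => k' _.
    by apply: eq_mean => r; rewrite -natrM mulnb.
  have -> : a * b * (a * b * p4 ^+ d + b * p3 ^+ d + a * p3 ^+ d + p ^+ d) =
      \sum_(i in A) \sum_(k in B) \sum_(i' in A) \sum_(k' in B) c i k i' k'.
    rewrite -mulrA {1}aE mulr_natl -sumr_const; apply: eq_bigr => i iA.
    rewrite {1}bE mulr_natl -sumr_const; apply: eq_bigr => k kB.
    have pick (D : {set 'I_N}) x : x \in D ->
        \sum_(y in D) (x == y)%:R = 1 :> R.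
      move=> xD; rewrite (bigD1 x)//= eqxx big1 ?addr0// => y /andP[_].
      by rewrite eq_sym => /negbTE ->.
    have inner i' : \sum_(k' in B) c i k i' k' =
        b * p4 ^+ d + p3 ^+ d + (i == i')%:R * (b * p3 ^+ d + p ^+ d).
      rewrite (eq_bigr (fun k' => p4 ^+ d + (i == i')%:R * p3 ^+ d +
        (k == k')%:R * (p3 ^+ d + (i == i')%:R * p ^+ d))); last first.
        by move=> k' _; rewrite /c -mulnb natrM; ring.
      rewrite big_split /= sumr_const -mulr_suml (pick B k kB).
      by rewrite -[_ *+ _]mulr_natl -bE; ring.
    rewrite (eq_bigr _ (fun i' _ => inner i')) big_split /= sumr_const.
    rewrite -mulr_suml (pick A i iA) -[_ *+ _]mulr_natl -aE; ring.
  do 2![apply: ler_sum => ? ?]; do 2![apply: ler_sum => ? ?].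
  exact: (near_all_cross_le AB).
have -> : mean (fun r => (~~ [exists i in A, exists k in B, near_all r i k])%:R)
    * E ^+ 2 = mean (fun r =>
    E ^+ 2 * (~~ [exists i in A, exists k in B, near_all r i k])%:R).
  by rewrite meanZ mulrC.
apply: (@le_trans _ _ (mean (fun r => (Y r - E) ^+ 2))).
  apply: ler_mean => r; case: exists_inP => [_|h]; first by rewrite mulr0 sqr_ge0.
  rewrite mulr1 /Y big1 ?sub0r ?sqrrN// => i iA; rewrite big1// => k kB.
  case: (boolP (near_all r i k)) => // ik; case: h; exists i => //.
  by apply/exists_inP; exists k.
have -> : mean (fun r => (Y r - E) ^+ 2) = mean (fun r => Y r ^+ 2) - E ^+ 2.
  have -> : mean (fun r => (Y r - E) ^+ 2) =
      mean (fun r => Y r ^+ 2 + (- (2 * E)) * Y r + E ^+ 2).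
    by apply: eq_mean => r; ring.
  by rewrite !meanD meanZ EY (mean_cst [ffun=> 1%g]); ring.
by rewrite lerB.
Qed.

End SecondMoment.

(** * Existence of a close pair *)

Lemma bernoulli_sub (R : realFieldType) (x : R) n : 0 <= x <= 1 ->
  1 - n%:R * x <= (1 - x) ^+ n.
Proof.
move=> /andP[x0 x1]; elim: n => [|n IH]; first by rewrite mul0r subr0.
rewrite exprS; apply: le_trans (ler_wpM2l _ IH); last by rewrite subr_ge0.
have := ler0n R n; rewrite -natr1; nra.
Qed.

Lemma count_interval_ge (P : pred nat) u v n : (v <= n)%N ->
  (forall b, u <= b < v -> P b)%N -> (v - u <= \sum_(b < n) P b)%N.
Proof.
move=> vn Pb; have [vu|uv] := leqP v u; first by rewrite (eqP vu).
rewrite -(big_mkord predT (fun b => nat_of_bool (P b))).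
rewrite (@big_cat_nat _ _ _ u) ?(leq_trans (ltnW uv))//=.
rewrite (@big_cat_nat _ _ _ v u) ?(ltnW uv)//=.
rewrite [X in (_ <= _ + (X + _))%N](eq_big_nat _ _ (F2 := fun=> 1%N)).
  by rewrite sum_nat_const_nat muln1 addnCA leq_addr.
by move=> b /Pb ->.
Qed.

Lemma count_interval_le (P : pred nat) u v n :
  (forall b, P b -> u <= b < v)%N -> (\sum_(b < n) P b <= v - u)%N.
Proof.
move=> Pb; have [vu|uv] := leqP v u.
  by rewrite big1// => b _; case: (boolP (P b)) => // /Pb; lia.
rewrite -(big_mkord predT (fun b => nat_of_bool (P b))).
apply: (@leq_trans (\sum_(0 <= b < n + v) P b)%N).
  by rewrite [leqRHS](@big_cat_nat _ _ _ n)//= ?leq_addr.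
rewrite (@big_cat_nat _ _ _ u)//=; last by lia.
rewrite (@big_cat_nat _ _ _ v u)//=; [|lia..].
rewrite big1_seq ?add0n; last first.
  move=> b; rewrite mem_index_iota => bb.
  by case: (boolP (P b)) => // /Pb; lia.
rewrite [X in (_ + X <= _)%N]big1_seq ?addn0; last first.
  move=> b; rewrite mem_index_iota => bb.
  by case: (boolP (P b)) => // /Pb; lia.
rewrite -[leqRHS]muln1 -sum_nat_const_nat.
by apply: leq_sum => b _; apply: leq_b1.
Qed.

Section ClosePairs.
Variables (R : realFieldType) (N m : nat).

Definition near_val (a b : 'I_N) := (a != b) && (a <= b + m)%N && (b <= a + m)%N.

Lemma near_val_sym : symmetric near_val.
Proof. by move=> a b; rewrite /near_val eq_sym -!andbA [X in _ && X]andbC. Qed.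

Lemma near_val_irr : irreflexive near_val.
Proof. by move=> a; rewrite /near_val eqxx. Qed.

(** A value close to an end of the interval has neighbours on one side only,
    whence the factor between the two bounds; they do not meet both ends because
    [m + m <= N]. *)
Lemma deg_near_val (a : 'I_N) : (m + m <= N)%N ->
  m%:R <= deg R near_val a <= m%:R + m%:R.
Proof.
move=> mN; rewrite /deg -natr_sum -natrD !ler_nat.
have aN := ltn_ord a; apply/andP; split.
  have [am|am] := leqP m a.
    rewrite (@leq_trans (a - (a - m))%N)//; first by rewrite subKn.
    apply: (@count_interval_ge (fun b => (a != b :> nat) && (a <= b + m)%N && (b <= a + m)%N)).
      exact: ltnW.
    by move=> b bb; lia.
  rewrite (@leq_trans (a.+1 + m - a.+1)%N)//; first by rewrite addKn.
  apply: (@count_interval_ge (fun b => (a != b :> nat) && (a <= b + m)%N && (b <= a + m)%N)); first by lia.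
  by move=> b bb; lia.
rewrite (eq_bigr (fun b : 'I_N => ((b < a) && (a <= b + m)) + ((a < b) && (b <= a + m)))%N).
  rewrite big_split leq_add//.
    apply: leq_trans (@count_interval_le (fun b => (b < a) && (a <= b + m))%N (a - m) a N _) _.
      by move=> b bb; lia.
    by lia.
  apply: leq_trans (@count_interval_le (fun b => (a < b) && (b <= a + m))%N a.+1 (a.+1 + m) N _) _.
    by move=> b bb; lia.
  by lia.
by move=> b _; rewrite /near_val -val_eqE /=; case: (ltngtP a b) => ab /=; lia.
Qed.

Variable d : nat.
Local Notation W := {ffun 'I_d -> 'S_N}.

Definition close_pair (r : W) :=
  [exists i : 'I_N, exists k : 'I_N, (i != k) && near_all near_val r i k].

(** [second_moment] for two halves of the indices.  The three terms come from the
    defect of independence of disjoint pairs, from the pairs that share a point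
    and from the inverse of the mean number of close pairs. *)
Lemma mean_no_close_pair_le : (0 < m)%N -> (m + m <= N)%N -> (0 < d)%N ->
  (12 * d <= N)%N ->
  mean (fun r => (~~ close_pair r)%:R) <=
    (12 * d%:R + 6 * 4 ^+ d) / N%:R
    + 9 * (N%:R / m%:R) ^+ d / N%:R ^+ 2 :> R.
Proof.
move=> m0 mN d0 dN.
have N12 : (12 <= N)%N by lia.
have NR : 12 <= N%:R :> R by rewrite ler_nat.
have N1 : N.-1%:R = N%:R - 1 :> R by rewrite -subn1 natrB//; lia.
have N2 : N.-2%:R = N%:R - 2 :> R by rewrite -subn2 natrB//; lia.
have N3 : N.-2.-1%:R = N%:R - 3 :> R.
  by rewrite -subn1 natrB ?N2//; [ring|lia].
have mR : 0 < m%:R :> R by rewrite ltr0n.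
set n : R := N%:R in NR N1 N2 N3 *.
set p := near_prob R near_val.
have degs a := deg_near_val a mN.
have pm : m%:R / n <= p.
  have h : n * m%:R <= \sum_a deg R near_val a.
    have -> : n * m%:R = \sum_(a : 'I_N) m%:R.
      by rewrite sumr_const card_ord mulr_natl.
    apply: ler_sum => a _.
    by case/andP: (degs a).
  rewrite /p /near_prob N1 -/n ler_pdivlMr; last by nra.
  apply: le_trans h; rewrite mulrA divfK; last by lra.
  by rewrite mulrC ler_wpM2r//; lra.
have p0 : 0 < p by apply: lt_le_trans pm; rewrite divr_gt0//; lra.
pose p3 := (m%:R + m%:R) * p / (n - 2).
pose p4 := n * (n - 1) * p ^+ 2 / ((n - 2) * (n - 3)).
have p3P (i k l : 'I_N) : i != k -> i != l -> k != l ->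
  mean (fun t : 'S_N => (near_val (t i) (t k) && near_val (t i) (t l))%:R) <= p3.
  move=> ik il kl; rewrite ler_pdivlMr; last by lra.
  rewrite mulrC -N2; apply: (mean_near_fork_le near_val_irr) => // a.
  by case/andP: (degs a).
have p4P (i k l o : 'I_N) : uniq [:: i; k; l; o] ->
  mean (fun t : 'S_N => (near_val (t i) (t k) && near_val (t l) (t o))%:R) <= p4.
  move=> u; rewrite ler_pdivlMr; last by apply: mulr_gt0; lra.
  by rewrite mulrC -N3 -N2 -N1; apply: (mean_near2_le _ near_val_irr).
have p3_ge0 : 0 <= p3.
  by apply: divr_ge0; [apply: mulr_ge0; [rewrite addr_ge0|exact: ltW]|lra].
have p4_ge0 : 0 <= p4.
  by rewrite divr_ge0// mulr_ge0 ?sqr_ge0// ?mulr_ge0//; lra.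
pose A := [set i : 'I_N | (i < N./2)%N].
have AB : [disjoint A & ~: A] by rewrite -finset.setI_eq0 finset.setICr.
have cA : #|A| = N./2.
  rewrite -sum1_card big_mkcond/=.
  rewrite (eq_bigr (fun i : 'I_N => nat_of_bool (i < N./2)%N)); last first.
    by move=> i _; rewrite inE; case: (_ < _)%N.
  apply/eqP; rewrite eqn_leq; apply/andP; split.
    apply: leq_trans (@count_interval_le (fun i => i < N./2)%N 0 N./2 N _) _ => //.
    by rewrite subn0.
  rewrite -[leqLHS]subn0.
  by apply: (@count_interval_ge (fun i => i < N./2)%N) => //; lia.
have cB : #|~: A| = (N - N./2)%N by rewrite cardsCs finset.setCK cA card_ord.
have := second_moment d near_val_sym near_val_irr p3_ge0 p4_ge0 p3P p4P AB
  (erefl _) (erefl _).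
set a : R := #|A|%:R; set b : R := #|~: A|%:R.
have an : n / 3 <= a.
  by rewrite /a cA ler_pdivrMr// -natrM ler_nat; lia.
have bn : n / 3 <= b.
  by rewrite /b cB ler_pdivrMr// -natrM ler_nat; lia.
rewrite -/p; set P := p ^+ d; set E := a * b * P.
set X := mean _; set X' := mean _ => hX.
have XX : X' <= X.
  apply: ler_mean => r; rewrite ler_nat.
  case: (boolP (close_pair r)) => // ncp.
  rewrite (_ : [exists i in A, _] = false)//; apply: contraNF ncp.
  case/exists_inP => i iA /exists_inP[k kA rik]; apply/existsP; exists i.
  apply/existsP; exists k; rewrite rik andbT; apply: contraTneq kA => <-.
  by rewrite inE iA.
clearbody p; have a0 : 0 < a by lra.
have b0 : 0 < b by lra.
have P0 : 0 < P by rewrite exprn_gt0.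
have E0 : 0 < E by rewrite !mulr_gt0.
have h3 : p3 ^+ d <= 4 ^+ d * P ^+ 2.
  have p40 : 0 <= 4 * p ^+ 2 by apply: mulr_ge0; rewrite ?sqr_ge0.
  rewrite /P -exprM mulnC exprM -exprMn lerXn2r ?nnegrE ?p3_ge0 ?p40//.
  rewrite /p3 ler_pdivrMr; last by lra.
  have : m%:R <= p * n by rewrite -ler_pdivrMr//; lra.
  move=> mp; rewrite mulrDl; apply: (@le_trans _ _ (2 * n * p ^+ 2)); nra.
have h4 : p4 ^+ d <= (1 + 12 * d%:R / n) * P ^+ 2.
  have -> : p4 = n * (n - 1) / ((n - 2) * (n - 3)) * p ^+ 2.
    by rewrite /p4 mulrAC.
  rewrite exprMn /P -!exprM [(2 * d)%N]mulnC ler_wpM2r ?exprn_ge0 ?(ltW p0)//.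
  set q := n * (n - 1) / ((n - 2) * (n - 3)).
  have dn : 12 * d%:R / n <= 1.
    by rewrite ler_pdivrMr ?mul1r; [rewrite -natrM ler_nat|lra].
  have q1 : (1 - 6 / n) * q <= 1.
    rewrite /q [leLHS]mulrA ler_pdivrMr; last by apply: mulr_gt0; lra.
    rewrite mulrBl [6 / n * _]mulrA divfK; last by lra.
    by nra.
  have q0 : 0 <= q by rewrite divr_ge0//; apply: mulr_ge0; lra.
  have n6 : 0 <= 6 / n <= 1.
    by rewrite divr_ge0 ?ler_pdivrMr ?mul1r//=; lra.
  have bern := bernoulli_sub d n6.
  have qd : 0 <= q ^+ d by rewrite exprn_ge0.
  have : (1 - d%:R * (6 / n)) * q ^+ d <= 1.
    apply: le_trans (ler_wpM2r qd bern) _.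
    rewrite -exprMn exprn_ile1// mulr_ge0// subr_ge0.
    by case/andP: n6.
  have -> : d%:R * (6 / n) = 12 * d%:R / n / 2.
    by field; lra.
  move: dn; have : 0 <= 12 * d%:R / n by rewrite divr_ge0 ?mulr_ge0//; lra.
  move: (12 * d%:R / n) => y; nra.
apply: le_trans XX _; rewrite -(ler_pM2r (_ : 0 < E ^+ 2)) ?exprn_gt0//.
apply: le_trans hX _.
have n0 : 0 < n by lra.
have ab : n / 3 * (n / 3) <= a * b by apply: ler_pM => //; lra.
have iP : P^-1 <= (n / m%:R) ^+ d.
  rewrite -[n / _]invrK exprVn lef_pV2 ?posrE ?exprn_gt0 ?invr_gt0 ?divr_gt0//.
  by rewrite invf_div /P lerXn2r ?nnegrE ?(ltW p0)// divr_ge0// ltW.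
have iab : (a * b)^-1 <= 9 / n ^+ 2.
  have -> : 9 / n ^+ 2 = (n / 3 * (n / 3))^-1 by field; lra.
  by rewrite lef_pV2 ?posrE ?mulr_gt0 ?invr_gt0//.
have ia : a^-1 <= 3 / n.
  by rewrite -[3 / n]invf_div lef_pV2 ?posrE ?divr_gt0//.
have ib : b^-1 <= 3 / n.
  by rewrite -[3 / n]invf_div lef_pV2 ?posrE ?divr_gt0//.
apply: (@le_trans _ _ ((12 * d%:R / n + (a^-1 + b^-1) * 4 ^+ d
    + (a * b)^-1 * P^-1) * E ^+ 2)); last first.
  rewrite ler_wpM2r ?sqr_ge0// lerD//.
    rewrite [leRHS]mulrDl lerD2l [leRHS]mulrAC ler_wpM2r ?exprn_ge0//.
    rewrite (_ : 6 / n = 3 / n + 3 / n); first exact: lerD.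
    by rewrite -mulrDl; congr (_ / _); ring.
  rewrite [leRHS]mulrAC ler_pM// ?invr_ge0 ?mulr_ge0 ?ltW//.
have -> : (12 * d%:R / n + (a^-1 + b^-1) * 4 ^+ d + (a * b)^-1 * P^-1) * E ^+ 2
  = a * b * (a * b * (12 * d%:R / n * P ^+ 2) + b * (4 ^+ d * P ^+ 2) +
       a * (4 ^+ d * P ^+ 2) + P).
  by rewrite /E; field; rewrite !lt0r_neq0.
have -> : E ^+ 2 = a * b * (a * b * P ^+ 2) by rewrite /E; ring.
rewrite -mulrBr ler_pM2l ?mulr_gt0//.
have abp : 0 < a * b by rewrite mulr_gt0.
move: (ler_wpM2l (ltW abp) h4) (ler_wpM2l (ltW a0) h3) (ler_wpM2l (ltW b0) h3).
set x4 := p4 ^+ d; set x3 := p3 ^+ d.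
rewrite mulrDl mul1r mulrDr; lra.
Qed.
End ClosePairs.

(** * Weights of a pair of cells *)

Section PairWeights.
Variables (R : realFieldType) (d N : nat).

Lemma mean_pair_weight_le (w : 'I_N -> 'I_N -> R) (c : R) i k :
    (forall a, \sum_(b | b != a) w a b <= c) -> i != k ->
  mean (fun t : 'S_N => w (t i) (t k)) <= c / N.-1%:R.
Proof.
move=> wc ik.
have N1 : (1 < N)%N.
  have := max_card (mem [set i; k]); rewrite card_ord cards2 ik; lia.
rewrite ler_pdivlMr; last by rewrite ltr0n; lia.
have := @mean_reveal R N [set i] k (fun a t => w (t i) a).
rewrite cardsC1 card_ord inE eq_sym ik mulrC => ->//; last first.
  by move=> a t t' e; rewrite e// set11.
rewrite -[leRHS](@mean_cst _ _ (1%g : 'S_N)); apply: ler_mean => t.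
apply: le_trans (wc (t i)).
rewrite [leRHS](reindex_inj (@perm_inj _ t)) /= le_eqVlt; apply/orP; left.
by apply/eqP/eq_bigl => y; rewrite !inE (inj_eq perm_inj).
Qed.

Lemma mean_pair_weights_le (w : 'I_N -> 'I_N -> R) (c : R) i k :
    (forall a b, 0 <= w a b) ->
    (forall a, \sum_(b | b != a) w a b <= c) -> i != k ->
  mean (fun r : {ffun 'I_d -> 'S_N} => \prod_j w (r j i) (r j k))
    <= (c / N.-1%:R) ^+ d.
Proof.
move=> w0 wc ik.
rewrite (mean_prod (fun _ (t : 'S_N) => w (t i) (t k))) prodr_const card_ord.
have wik := mean_pair_weight_le wc ik.
have mw0 : 0 <= mean (fun t : 'S_N => w (t i) (t k)) by apply: mean_ge0.
by rewrite lerXn2r ?nnegrE//; apply: le_trans wik.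
Qed.

(** The number [s + 1 - t] clipped to the unit interval, written as an increment
    so that sums over [t] telescope. *)
Definition clip_weight (s : R) (t : nat) : R :=
  Num.min s t%:R - Num.min s t.-1%:R.

Lemma clip_weight_ge0 s t : 0 <= clip_weight s t.
Proof.
rewrite subr_ge0 le_min ge_min lexx /= ge_min.
by apply/orP; right; rewrite ler_nat leq_pred.
Qed.

Lemma sum_clip_weight_le s (a : 'I_N) : 0 <= s ->
  \sum_(b < N | b != a) clip_weight s ((a - b) + (b - a)) <= s + s.
Proof.
move=> s0; pose f (t : nat) : R := Num.min s t%:R.
have f0 : f 0%N = 0 by rewrite /f; case: ltgtP s0 => // <-.
have fs t : f t <= s by rewrite ge_min lexx.
rewrite (bigID (fun b : 'I_N => b < a)%N) /= lerD//.
  rewrite (eq_bigl (fun b : 'I_N => b < a)%N); last first.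
    by move=> b; rewrite -val_eqE /=; case: ltngtP.
  have -> : \sum_(b < N | (b < a)%N) clip_weight s ((a - b) + (b - a)) =
      \sum_(0 <= b < a) (- f (a - b.+1)%N - - f (a - b)%N).
    rewrite big_mkord (big_ord_widen N (fun b => - f (a - b.+1)%N - - f (a - b)%N)).
      apply: eq_bigr => b ba; rewrite /clip_weight opprK addrC.
      by rewrite (_ : (b - a = 0)%N) ?addn0 ?subnS//; lia.
    exact: ltnW.
  by rewrite telescope_sumr// subnn f0 oppr0 add0r opprK subn0.
have -> : \sum_(b < N | (b != a) && ~~ (b < a)%N)
    clip_weight s ((a - b) + (b - a)) =
    \sum_(a.+1 <= b < N) (f (b.+1 - a.+1)%N - f (b - a.+1)%N).
  rewrite big_geq_mkord; apply: eq_big => b.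
    by rewrite -val_eqE /=; case: ltngtP.
  rewrite -val_eqE /= => ba; rewrite /clip_weight -/(f _) -/(f _).
  congr (f _ - f _); lia.
rewrite telescope_sumr ?ltn_ord//.
by rewrite subnn f0 subr0.
Qed.

End PairWeights.
(** * The law of the permutations and of the uniform variables *)

Local Open Scope classical_set_scope.
Local Open Scope ring_scope.

Lemma uniform01E (R : realType) (A : set R) : measurable A ->
  uniform_prob (@ltr01 R) A = lebesgue_measure (A `&` `[0, 1]).
Proof.
move=> mA; rewrite /uniform_prob integral_uniform_pdf.
rewrite (eq_integral (fun=> 1%E)); last first.
  move=> x; rewrite inE/= in_itv/= => -[_ x01].
  by rewrite /uniform_pdf x01 subr0 invr1.
rewrite integral_cst ?mul1e//; exact: measurableI.
Qed.

Lemma uniform01_itv_le (R : realType) (x y : R) : x <= y ->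
  (lebesgue_measure (`[x, y] : set R) <= (y - x)%:E)%E.
Proof.
move=> xy; rewrite lebesgue_measure_itv/= lte_fin.
by case: ifP => _; rewrite -?EFinD// lee_fin subr_ge0.
Qed.

(** For cells at distance [t] the gap is at most [s] only if the point of the
    lower cell is in the top part of that cell. *)
Lemma uniform01_ge_le (R : realType) (s : R) t : (0 < t)%N -> 0 <= s ->
  (uniform_prob (@ltr01 R) `[(t%:R - s)%R, +oo[%classic <= (clip_weight s t)%:E)%E.
Proof.
case: t => // t _ s0; rewrite uniform01E//=.
have [st|ts] := ltP s t%:R.
  rewrite (_ : _ `&` _ = set0) ?measure0 ?lee_fin ?clip_weight_ge0//; last first.
    apply/seteqP; split => // x /=; rewrite !in_itv/= andbT -natr1 => -[]; lra.
rewrite /clip_weight/= -natr1.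
have [st1|ts1] := ltP s (t%:R + 1).
  apply: (@le_trans _ _ (lebesgue_measure (`[t%:R + 1 - s, 1] : set R))).
    apply: le_measure; rewrite ?inE//=; first exact: measurableI.
    by move=> x /=; rewrite !in_itv/= andbT => -[-> /andP[_ ->]].
  apply: le_trans (uniform01_itv_le _) _; first by lra.
  by rewrite lee_fin (min_r ts); lra.
apply: (@le_trans _ _ (lebesgue_measure (`[0, 1] : set R))).
  by apply: le_measure; rewrite ?inE//=; first exact: measurableI.
apply: le_trans (uniform01_itv_le _) _; first by lra.
by rewrite lee_fin (min_r ts); lra.
Qed.

(** The symmetric case: the point of the upper cell is in the bottom part of
    that cell. *)
Lemma uniform01_le_le (R : realType) (s : R) t : (0 < t)%N -> 0 <= s ->
  (uniform_prob (@ltr01 R) `]-oo, (s + 1 - t%:R)%R]%classic <= (clip_weight s t)%:E)%E.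
Proof.
case: t => // t _ s0; rewrite uniform01E//=.
have [st|ts] := ltP s t%:R.
  rewrite (_ : _ `&` _ = set0) ?measure0 ?lee_fin ?clip_weight_ge0//; last first.
    apply/seteqP; split => // x /=; rewrite !in_itv/= -natr1 => -[]; lra.
rewrite /clip_weight/= -natr1.
have [st1|ts1] := ltP s (t%:R + 1).
  apply: (@le_trans _ _ (lebesgue_measure (`[0, s + 1 - (t%:R + 1)] : set R))).
    apply: le_measure; rewrite ?inE//=; first exact: measurableI.
    by move=> x /=; rewrite !in_itv/= => -[-> /andP[-> _]].
  apply: le_trans (uniform01_itv_le _) _; first by lra.
  by rewrite lee_fin (min_r ts); lra.
apply: (@le_trans _ _ (lebesgue_measure (`[0, 1] : set R))).
  by apply: le_measure; rewrite ?inE//=; first exact: measurableI.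
apply: le_trans (uniform01_itv_le _) _; first by lra.
by rewrite lee_fin (min_r ts); lra.
Qed.

Lemma union_bound (R : realType) (d : measure_display) (T : measurableType d)
    (mu : {measure set T -> \bar R}) (I : finType) (A : set T) (F : I -> set T) :
    measurable A -> (forall i, measurable (F i)) -> A `<=` \bigcup_i F i ->
  (mu A <= \sum_i mu (F i))%E.
Proof.
move=> mA mF AF.
have mu_seq (s : seq I) : (mu (\big[setU/set0]_(i <- s) F i) <=
    \sum_(i <- s) mu (F i))%E.
  elim: s => [|i s IH]; first by rewrite !big_nil measure0.
  rewrite !big_cons; apply: le_trans (leeD2l _ IH).
  by apply: measureU2 => //; apply: bigsetU_measurable.
apply: le_trans (mu_seq _); apply: le_measure; rewrite ?inE//.
  exact: bigsetU_measurable.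
move=> w /AF[i _ Fi]; rewrite -bigcup_seq; exists i => //=.
exact: mem_index_enum.
Qed.

Section Law.
Variables (R : realType) (dO : measure_display) (Omega : measurableType dO).
Variables (P : probability Omega R) (d N : nat).
Variables (perm : 'I_d -> Omega -> 'S_N) (U : 'I_N -> 'I_d -> {RV P >-> R}).
Hypothesis H : lhs_randomness perm U.
Local Notation W := {ffun 'I_d -> 'S_N}.

Definition perms (w : Omega) : W := [ffun j => perm j w].

Lemma law_product (r : W) (V : 'I_N -> 'I_d -> set R) :
    (forall i j, measurable (V i j)) ->
  P [set w | perms w = r /\ forall i j, V i j (U i j w)] =
  (((N`!%:R)^-1 ^+ d)%:E *
   \prod_(ij : 'I_N * 'I_d) uniform_prob (@ltr01 R) (V ij.1 ij.2))%E.
Proof.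
move=> mV.
pose E (k : 'I_d + 'I_N * 'I_d) : set Omega := match k with
  | inl j => perm j @^-1` [set r j]
  | inr ij => U ij.1 ij.2 @^-1` V ij.1 ij.2 end.
have -> : [set w | perms w = r /\ forall i j, V i j (U i j w)] =
    \bigcap_(i in [set` [set: 'I_d + 'I_N * 'I_d]%SET]) E i.
  apply/seteqP; split => [w [e h] [j|[i j]] _ /=|w h].
  - by rewrite -e ffunE.
  - exact: h.
  split.
    by apply/ffunP => j; have := h (inl j); rewrite /= inE ffunE; apply.
  by move=> i j; have := h (inr (i, j)); rewrite /= inE; apply.
rewrite (lhs_independent H); last first.
  move=> [j|[i j]] _ /=.
    by exists [set r j] => //; rewrite setTI.
  by exists (V i j) => //; rewrite setTI.
rewrite (eq_bigl predT); last by move=> i; rewrite inE.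
rewrite big_sumType/=; congr (_ * _)%E.
  under eq_bigr do rewrite (lhs_perm_uniform H).
  by rewrite prodEFin prodr_const card_ord.
apply: eq_bigr => -[i j] _ /=.
by rewrite -(lhs_U_uniform H i j (mV i j)).
Qed.

Lemma measurable_perms_eq (r : W) : measurable [set w | perms w = r].
Proof.
have -> : [set w | perms w = r] = \bigcap_(j in setT) (perm j @^-1` [set r j]).
  apply/seteqP; split => [w <- j _ /=|w h]; first by rewrite ffunE.
  by apply/ffunP => j; rewrite ffunE; apply: h.
apply: fin_bigcap_measurable => [|j _]; first exact: finite_finset.
exact: (lhs_perm_measurable H).
Qed.

Lemma measurable_perms (Q : W -> set Omega) : (forall r, measurable (Q r)) ->
  measurable [set w | Q (perms w) w].
Proof.
move=> mQ.
have -> : [set w | Q (perms w) w] =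
    \bigcup_(r in [set: W]) ([set w | perms w = r] `&` Q r).
  by apply/seteqP; split => [w h|w [r _ [<-]]//]; exists (perms w).
apply: fin_bigcup_measurable => [|r _]; first exact: finite_finset.
apply: measurableI => //; exact: measurable_perms_eq.
Qed.

Lemma measurable_noise_event (V : 'I_N -> 'I_d -> set R) : (forall i j, measurable (V i j)) ->
  measurable [set w | forall i j, V i j (U i j w)].
Proof.
move=> mV.
have -> : [set w | forall i j, V i j (U i j w)] =
    \bigcap_(ij in [set: 'I_N * 'I_d]) (U ij.1 ij.2 @^-1` V ij.1 ij.2).
  apply/seteqP; split => [w h [i j] _|w h i j]; first exact: h.
  exact: (h (i, j) Logic.I).
apply: fin_bigcap_measurable => [|ij _]; first exact: finite_finset.
rewrite -[X in measurable X]setTI; exact: measurable_funP.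
Qed.

(** Events are decomposed along the values of the permutations, since
    independence only gives the probabilities of events in product form. *)
Lemma law_mean_le (Q : W -> bool) (V : W -> 'I_N -> 'I_d -> set R) (v : W -> R) :
    (forall r i j, measurable (V r i j)) -> (forall r, 0 <= v r) ->
    (forall r, Q r -> (\prod_(ij : 'I_N * 'I_d)
       uniform_prob (@ltr01 R) (V r ij.1 ij.2) <= (v r)%:E)%E) ->
  (P [set w | Q (perms w) /\ forall i j, V (perms w) i j (U i j w)]
    <= (mean v)%:E)%E.
Proof.
move=> mV v0 Vv.
pose E (r : W) := [set w | perms w = r /\ forall i j, V r i j (U i j w)].
pose F (r : W) : set Omega := if Q r then E r else set0.
have mE r : measurable (E r).
  by apply: measurableI; [exact: measurable_perms_eq|exact: measurable_noise_event].
have mF r : measurable (F r) by rewrite /F; case: ifP.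
apply: le_trans (@union_bound _ _ _ P W _ F _ mF _) _.
- apply: (measurable_perms (Q := fun r => [set w | Q r /\ forall i j, V r i j (U i j w)])).
  move=> r; case: (Q r); last by rewrite (_ : [set _ | _] = set0)//; apply/seteqP; split => // w [].
  rewrite (_ : [set _ | _] = [set w | forall i j, V r i j (U i j w)]); first exact: measurable_noise_event.
  by apply/seteqP; split => w //= [].
- by move=> w [Qw h]; exists (perms w) => //; rewrite /F Qw.
rewrite /mean mulr_sumr -sumEFin; apply: lee_sum => r _.
rewrite EFinM card_ffun card_ord card_Sn natrX -exprVn /F.
case: ifPn => Qr; last by rewrite measure0 -EFinM lee_fin mulr_ge0.
rewrite [leLHS](law_product r (mV r)); apply: lee_wpmul2l; first by rewrite lee_fin.
exact: Vv.
Qed.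

Lemma law_perms_le (Q : W -> bool) :
  (P [set w | Q (perms w)] <= (mean (fun r => (Q r)%:R))%:E)%E.
Proof.
have := @law_mean_le Q (fun _ _ _ => setT) (fun r => (Q r)%:R).
have -> : [set w | Q (perms w) /\ forall i j, setT (U i j w)] =
    [set w | Q (perms w)] by apply/seteqP; split => w; [case|split].
apply => // r Qr; rewrite Qr big1// => ij _; exact: probability_setT.
Qed.

Definition unit_event : set Omega := [set w | forall i j, 0 <= U i j w <= 1].

Lemma measurable_unit_event : measurable unit_event.
Proof.
apply: (measurable_noise_event (V := fun _ _ => [set x | 0 <= x <= 1])) => _ _.
by rewrite -set_itvcc; exact: measurable_itv.
Qed.

Lemma unit_event_ae : P (~` unit_event) = 0%E.
Proof.
have mU := measurable_unit_event.
have mI : measurable (~` `[0%R, 1%R]%classic : set R) by exact: measurableC.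
apply/eqP; rewrite eq_le measure_ge0 andbT.
pose F (ij : 'I_N * 'I_d) : set Omega :=
  U ij.1 ij.2 @^-1` (~` `[0%R, 1%R]%classic).
apply: le_trans (@union_bound _ _ _ P _ _ F _ _ _) _.
- exact: measurableC.
- by move=> ij; rewrite -[F ij]setTI; exact: measurable_funP.
- move=> w /existsNP[i /existsNP[j h]]; exists (i, j) => //.
rewrite big1// => ij _.
transitivity (distribution P (U ij.1 ij.2) (~` `[0%R, 1%R]%classic)) => //.
by rewrite (lhs_U_uniform H ij.1 ij.2 mI) uniform01E// setICl measure0.
Qed.
End Law.

(** * Separation and covering radius of a configuration *)

Section Configurations.
Variables (R : realType) (d N : nat).
Implicit Types (v z : 'rV[R]_d) (x : 'I_N -> 'rV[R]_d) (t : R).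

Lemma sup_norm_leP v t : 0 <= t ->
  reflect (forall j, `|v ord0 j| <= t) (`|v| <= t).
Proof.
move=> t0; apply: (iffP idP) => [vt j|h].
  apply: le_trans vt; rewrite /Num.Def.normr/= mx_normrE.
  by rewrite (le_bigmax _ (fun ij => `|v ij.1 ij.2|) (ord0, j)).
rewrite /Num.Def.normr/= mx_normrE; apply/bigmax_leP; split => // -[i j] _ /=.
by rewrite (ord1 i).
Qed.

Lemma sup_norm_gtP v t : 0 <= t ->
  reflect (exists j, t < `|v ord0 j|) (t < `|v|).
Proof.
move=> t0; rewrite ltNge; apply: (iffP idP) => [/(sup_norm_leP _ t0)|[j tj]].
  by move=> /existsNP[j /negP]; rewrite -ltNge; exists j.
by apply/negP => /(sup_norm_leP _ t0)/(_ j); rewrite leNgt tj.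
Qed.

Lemma separation_gtP x t :
  (t%:E < separation x)%E <->
  (forall i k : 'I_N, (i < k)%N -> t < `|x i - x k|).
Proof.
rewrite /separation; split => [/bigmin_gtP[_ h] i k ik|h].
  by rewrite -lte_fin; exact: (h (i, k)).
by apply/bigmin_gtP; split; [exact: ltry|move=> [i k] ik; rewrite lte_fin h].
Qed.

Lemma separation_ltP x t :
  (separation x < t%:E)%E <->
  (exists i k : 'I_N, (i < k)%N /\ `|x i - x k| < t).
Proof.
split => [|[i [k [ik xt]]]].
  rewrite ltNge => /negP h; apply: contrapT => h'; apply: h.
  apply: le_bigmin => [|[i k] /= ik]; first exact: leey.
  rewrite lee_fin leNgt; apply/negP => xt; apply: h'; by exists i, k.
apply: le_lt_trans (_ : (`|x i - x k|)%:E < _)%E; last by rewrite lte_fin.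
exact: (@bigmin_le_cond _ _ _ +oo%E (i, k)).
Qed.

Lemma separation_ge0 x : (0 <= separation x)%E.
Proof. by apply: le_bigmin => [|p _]; rewrite ?leey ?lee_fin. Qed.

Lemma separation_fin x : (2 <= N)%N -> (separation x < +oo)%E.
Proof.
case: N x => [|[|n]] // x _.
apply: le_lt_trans (@bigmin_le_cond _ _ _ +oo%E (ord0, ord_max) _ _ _) _ => //.
exact: ltry.
Qed.

Lemma covering_gtP x t :
  (t%:E < covering_radius x)%E <->
  (exists2 z, unit_cube R d z & forall n, t < `|z - x n|).
Proof.
rewrite /covering_radius; split.
  case/ereal_sup_gt => _ [z zu <-] /bigmin_gtP[_ h]; exists z => // n.
  by rewrite -lte_fin; apply: h.
case=> z zu h; apply/ereal_sup_gtP; eexists; first by exists z.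
by apply/bigmin_gtP; split; [exact: ltry|move=> n _; rewrite lte_fin].
Qed.

Lemma covering_ge0 x : (0 <= covering_radius x)%E.
Proof.
apply: le_ereal_sup_tmp.
exists (\big[Order.min/+oo%E]_(n < N) (`|0 - x n|)%:E).
  by exists 0 => // j; rewrite mxE lexx ler01.
by apply: le_bigmin => [|p _]; rewrite ?leey ?lee_fin.
Qed.

(** The points of the cube with common denominator [M + 1]; when [M] varies they
    form a countable dense subset of the cube. *)
Definition grid_point (M : nat) (g : {ffun 'I_d -> 'I_M.+2}) : 'rV[R]_d :=
  \row_j ((g j)%:R / M.+1%:R).

Lemma grid_point_unit M g : unit_cube R d (@grid_point M g).
Proof.
move=> j; rewrite mxE divr_ge0//= ler_pdivrMr ?ltr0n// mul1r ler_nat.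
by rewrite -ltnS.
Qed.

Lemma grid_approx z M : unit_cube R d z ->
  exists g : {ffun 'I_d -> 'I_M.+2}, `|z - grid_point g| <= M.+1%:R^-1.
Proof.
move=> zu.
have tr j : (Num.trunc (z ord0 j * M.+1%:R) < M.+2)%N.
  have /andP[z0 z1] := zu j.
  have zM0 : 0 <= z ord0 j * M.+1%:R by rewrite mulr_ge0.
  rewrite ltnS -(ler_nat R); apply: (@le_trans _ _ (z ord0 j * M.+1%:R)).
    by rewrite truncn_le.
  by rewrite ger_pMl// ltr0n.
exists [ffun j => Ordinal (tr j)]; apply/sup_norm_leP; first by rewrite invr_ge0.
move=> j; rewrite !mxE ffunE/=; have /andP[z0 z1] := zu j.
have M0 : 0 < M.+1%:R :> R by rewrite ltr0n.
have /andP[h1 h2] := truncn_itv (mulr_ge0 z0 (ltW M0)).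
rewrite -[X in _ < X]natr1 in h2.
have -> : z ord0 j - (Num.trunc (z ord0 j * M.+1%:R))%:R / M.+1%:R =
  (z ord0 j * M.+1%:R - (Num.trunc (z ord0 j * M.+1%:R))%:R) / M.+1%:R.
  by rewrite mulrBl mulfK// gt_eqF.
rewrite normrM [`|_^-1|]ger0_norm ?invr_ge0// ler_piMl ?invr_ge0//.
by rewrite ger0_norm ?subr_ge0//; lra.
Qed.

(** The condition on the center is open, so that it may be moved to a grid point:
    the covering radius is a countable supremum. *)
Lemma covering_gt_grid x t :
  (t%:E < covering_radius x)%E <->
  (exists M, exists g : {ffun 'I_d -> 'I_M.+2},
     forall n, t < `|grid_point g - x n|).
Proof.
rewrite covering_gtP; split => [[z zu h]|[M [g h]]]; last first.
  by exists (grid_point g) => //; exact: grid_point_unit.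
pose e : R := \big[Order.min/1]_(n < N) (`|z - x n| - t).
have e0 : 0 < e by apply/bigmin_gtP; split => // n _; rewrite subr_gt0.
exists (Num.trunc e^-1).
have [g zg] := grid_approx (Num.trunc e^-1) zu.
exists g => n.
have en : e <= `|z - x n| - t by apply: bigmin_le_cond.
have e1 : (Num.trunc e^-1).+1%:R^-1 < e.
  rewrite -[ltRHS]invrK ltf_pV2 ?posrE ?invr_gt0 ?ltr0n//.
  exact: truncnS_gt.
have zge := le_lt_trans zg e1.
have : `|z - x n| <= `|z - grid_point g| + `|grid_point g - x n|.
  by rewrite (le_trans _ (ler_normD _ _))// addrA subrK.
by move: zge en; clear; lra.
Qed.
End Configurations.

Lemma emeasurable_fun_gt (R : realType) (d : measure_display)
    (T : measurableType d) (f : T -> \bar R) :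
  (forall t : R, measurable [set w | (t%:E < f w)%E]) ->
  measurable_fun [set: T] f.
Proof.
move=> h mT; apply: (measurability _ (ErealGenOInfty.measurableE R)) => //.
move=> _ [_ [t ->] <-]; rewrite setTI preimage_itvoy; exact: h.
Qed.

(** * Measurability of the separation and of the covering radius *)

Section Measurability.
Variables (R : realType) (dO : measure_display) (Omega : measurableType dO).
Variables (P : probability Omega R) (d N : nat).
Variables (perm : 'I_d -> Omega -> 'S_N) (U : 'I_N -> 'I_d -> {RV P >-> R}).
Hypothesis H : lhs_randomness perm U.
Local Notation X := (lhs_sample perm U).

Lemma measurable_coord i j : measurable_fun [set: Omega] (fun w => X w i ord0 j).
Proof.
under eq_fun do rewrite mxE.
apply: measurable_funM => //; apply: measurable_funD => //.
move=> _ B mB; rewrite setTI.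
have -> : (fun w => (perm j w i)%:R) @^-1` B =
    \bigcup_(s in [set s : 'S_N | B (s i)%:R]) (perm j @^-1` [set s]).
  apply/seteqP; split => [w h|w [s sB ps]]; first by exists (perm j w).
  by move: sB; rewrite -ps.
apply: fin_bigcup_measurable => [|s _]; first exact: finite_finset.
exact: (lhs_perm_measurable H).
Qed.

Lemma measurable_norm_gt (v : Omega -> 'rV[R]_d) t :
    (forall j, measurable_fun [set: Omega] (fun w => v w ord0 j)) ->
  measurable [set w | t < `|v w|].
Proof.
move=> mv; have [t0|t0] := ltP t 0.
  rewrite (_ : [set _ | _] = setT); first exact: measurableT.
  by apply/seteqP; split => // w _ /=; apply: lt_le_trans t0 _.
have -> : [set w | t < `|v w|] =
    \bigcup_(j in [set: 'I_d]) [set w | t < `|v w ord0 j|].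
  by apply/seteqP; split => [w /(sup_norm_gtP _ t0)[j]|w [j _]] h;
    [exists j|apply/(sup_norm_gtP _ t0); exists j].
apply: fin_bigcup_measurable => [|j _]; first exact: finite_finset.
have := @measurable_fun_ltr _ _ _ setT (cst t) (fun w => `|v w ord0 j|)
  (measurable_cst _) (measurableT_comp (@normr_measurable _ _) (mv j)).
move=> /(_ measurableT [set true] Logic.I); rewrite setTI.
by congr (measurable _); apply/seteqP; split => w /=.
Qed.

Lemma measurable_separation :
  measurable_fun [set: Omega] (fun w => separation (X w)).
Proof.
apply: emeasurable_fun_gt => t.
have -> : [set w | (t%:E < separation (X w))%E] =
    \bigcap_(p in [set p : 'I_N * 'I_N | (p.1 < p.2)%N])
      [set w | t < `|X w p.1 - X w p.2|].
  apply/seteqP; split => w.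
    by move=> /separation_gtP h [i k] /= ik; apply: h.
  by move=> h; apply/separation_gtP => i k ik; apply: (h (i, k)).
apply: fin_bigcap_measurable => [|p _]; first exact: finite_finset.
apply: (@measurable_norm_gt (fun w => X w p.1 - X w p.2)) => j.
have := measurable_funB (measurable_coord p.1 j) (measurable_coord p.2 j).
by congr (measurable_fun _ _); apply/funext => w; rewrite /= !mxE.
Qed.

Lemma measurable_covering :
  measurable_fun [set: Omega] (fun w => covering_radius (X w)).
Proof.
apply: emeasurable_fun_gt => t.
have -> : [set w | (t%:E < covering_radius (X w))%E] =
    \bigcup_M \bigcup_(g in [set: {ffun 'I_d -> 'I_M.+2}])
      \bigcap_(n in [set: 'I_N]) [set w | t < `|grid_point R g - X w n|].
  apply/seteqP; split => w.
    by move=> /covering_gt_grid[M [g h]]; exists M => //; exists g => // n _; apply: h.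
  by move=> [M _ [g _ h]]; apply/covering_gt_grid; exists M, g => n; apply: h.
apply: bigcup_measurable => M _.
apply: fin_bigcup_measurable => [|g _]; first exact: finite_finset.
apply: fin_bigcap_measurable => [|n _]; first exact: finite_finset.
apply: (@measurable_norm_gt (fun w => grid_point R g - X w n)) => j.
have := measurable_funB (@measurable_cst _ _ _ _ setT (grid_point R g ord0 j)) (measurable_coord n j).
by congr (measurable_fun _ _); apply/funext => w; rewrite /= !mxE.
Qed.
End Measurability.

(** * Probabilities of extreme separations *)

Lemma le_prode (R : realType) (I : finType) (f : I -> \bar R) (g : I -> R) :
  (forall i, 0 <= f i <= (g i)%:E)%E -> (\prod_i f i <= (\prod_i g i)%:E)%E.
Proof.
move=> fg; suff : (0 <= \prod_i f i <= (\prod_i g i)%:E)%E by case/andP.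
elim/big_rec2: _ => [|i y x _ /andP[y0 yx]]; first by rewrite lee01 lexx.
have /andP[f0 fgi] := fg i.
by rewrite mule_ge0//= EFinM lee_pmul.
Qed.

Section Events.
Variables (R : realType) (dO : measure_display) (Omega : measurableType dO).
Variables (P : probability Omega R) (d N : nat).
Variables (perm : 'I_d -> Omega -> 'S_N) (U : 'I_N -> 'I_d -> {RV P >-> R}).
Hypothesis H : lhs_randomness perm U.
Local Notation W := {ffun 'I_d -> 'S_N}.
Local Notation X := (lhs_sample perm U).
Local Notation r := (perms perm).

Lemma prob_unit_le (A : set Omega) : measurable A ->
  (P A <= P (A `&` unit_event U))%E.
Proof.
move=> mA; have mU := measurable_unit_event U.
have mAU : measurable (A `&` unit_event U) by exact: measurableI.
rewrite -[leRHS]adde0 -(unit_event_ae H).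
apply: le_trans (measureU2 _ _ _); rewrite ?inE//; last exact: measurableC.
apply: le_measure; rewrite ?inE//.
  by apply: measurableU => //; exact: measurableC.
by move=> w Aw; have [Uw|Uw] := pselect (unit_event U w); [left|right].
Qed.

Lemma measurable_perms_pred (Q : W -> bool) : measurable [set w | Q (r w)].
Proof.
apply: (measurable_perms H (Q := fun s => [set _ | Q s])) => s; case: (Q s).
  by rewrite (_ : [set _ | _] = setT)//; apply/seteqP; split.
by rewrite (_ : [set _ | _] = set0)//; apply/seteqP; split.
Qed.

(** Outside a null event the uniform variables are in the unit interval, and then an
    event may imply a condition on the permutations alone. *)
Lemma prob_perms_le (A : set Omega) (Q : W -> bool) : measurable A ->
    (forall w, unit_event U w -> A w -> Q (r w)) ->
  (P A <= (mean (fun s => (Q s)%:R))%:E)%E.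
Proof.
move=> mA AQ; apply: le_trans (prob_unit_le mA) (le_trans _ (law_perms_le H Q)).
apply: le_measure; rewrite ?inE//; last by move=> w [Aw Uw]; exact: AQ.
  by apply: measurableI => //; exact: measurable_unit_event.
exact: measurable_perms_pred.
Qed.

Lemma sample_coord w n j : X w n ord0 j = ((r w j n)%:R + U n j w) / N%:R.
Proof. by rewrite mxE ffunE. Qed.

Hypothesis N_gt0 : (0 < N)%N.
Let N_R : 0 < N%:R :> R. Proof. by rewrite ltr0n. Qed.

(** Cells at distance at most [m] contain points at distance at most
    [(m + 1) / N]. *)
Lemma separation_large_prob (m : nat) (t : R) : m.+1%:R / N%:R <= t ->
  (P [set w | t%:E < separation (X w)] <=
   (mean (fun s : W => (~~ close_pair m s)%:R))%:E)%E.
Proof.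
move=> mt; apply: (prob_perms_le (Q := fun s => ~~ close_pair m s)).
  have := emeasurable_fun_o_infty measurableT (measurable_separation H) t%:E.
  by rewrite setTI.
move=> w Uw /separation_gtP sep; apply/negP => /existsP[i /existsP[k /andP[ik]]].
wlog ltik : i k ik / (i < k)%N.
  move=> h; case: (ltngtP i k) => [|ki|/val_inj e]; first exact: h.
    move=> /forallP nr; apply: (h k i) => //; first by rewrite eq_sym.
    by apply/forallP => j; rewrite near_val_sym.
  by rewrite e eqxx in ik.
move=> /forallP near; have := sep i k ltik; rewrite ltNge => /negP; apply.
have t0 : 0 <= t by apply: le_trans mt; rewrite divr_ge0.
apply/(sup_norm_leP _ t0) => j; have /andP[/andP[_ h1] h2] := near j.
have -> : (X w i - X w k) ord0 j = X w i ord0 j - X w k ord0 j by rewrite !mxE.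
rewrite !sample_coord -mulrBl normrM [`|_^-1|]ger0_norm ?invr_ge0 ?(ltW N_R)//.
apply: le_trans mt; rewrite ler_wpM2r ?invr_ge0 ?(ltW N_R)//.
have /andP[u0 u1] := Uw i j; have /andP[v0 v1] := Uw k j.
move: h1 h2; rewrite -!(ler_nat R) !natrD -[m.+1%:R]natr1 ler_norml => h1 h2.
by apply/andP; split; lra.
Qed.

(** A product event containing the event that the points [i] and [k] are at
    distance at most [s / N], when all the uniform variables are in the unit
    interval: those of the point [k] are eliminated by bounding them by [0] or
    [1]. *)
Definition pair_event (s : R) (i k : 'I_N) (q : W) (n : 'I_N) (j : 'I_d) : set R :=
  if n == i then
    (if (q j i < q j k)%N
     then `[((q j i - q j k) + (q j k - q j i))%:R - s, +oo[%classic
     else `]-oo, s + 1 - ((q j i - q j k) + (q j k - q j i))%:R]%classic)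
  else setT.

Lemma pair_event_prob s i k : 0 <= s -> i != k ->
  (P [set w | forall n j, pair_event s i k (r w) n j (U n j w)] <=
    (((s + s) / N.-1%:R) ^+ d)%:E)%E.
Proof.
move=> s0 ik.
pose v (q : W) : R := \prod_j clip_weight s ((q j i - q j k) + (q j k - q j i)).
have v0 q : 0 <= v q by apply: prodr_ge0 => j _; exact: clip_weight_ge0.
have mV q n j : measurable (pair_event s i k q n j).
  by rewrite /pair_event; case: ifP => // _; case: ifP.
have -> : [set w | forall n j, pair_event s i k (r w) n j (U n j w)] =
   [set w | predT (r w) /\ forall n j, pair_event s i k (r w) n j (U n j w)].
  by apply/seteqP; split => w //= [].
apply: le_trans (law_mean_le H (v := v) mV v0 _) _.
  move=> q _.
  rewrite -(pair_bigA _ (fun n j => uniform_prob (@ltr01 R) (pair_event s i k q n j)))/=.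
  rewrite (bigD1 i)//= [X in (_ * X)%E]big1 ?mule1; last first.
    move=> n ni; rewrite big1// => j _; rewrite /pair_event (negbTE ni).
    exact: probability_setT.
  apply: le_prode => j; rewrite measure_ge0/= /pair_event eqxx.
  have t0 : (0 < (q j i - q j k) + (q j k - q j i))%N.
    have : q j i != q j k :> nat by rewrite val_eqE (inj_eq perm_inj).
    lia.
  by case: ifP => _; [exact: uniform01_ge_le|exact: uniform01_le_le].
rewrite lee_fin; apply: (@mean_pair_weights_le R d N (fun a b => clip_weight s ((a - b) + (b - a)))) => //.
  by move=> a b; exact: clip_weight_ge0.
by move=> a; exact: sum_clip_weight_le.
Qed.

Lemma separation_small_prob (s : R) : 0 <= s ->
  (P [set w | separation (X w) < (s / N%:R)%:E] <=
   (N%:R ^+ 2 * ((s + s) / N.-1%:R) ^+ d)%:E)%E.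
Proof.
move=> s0.
pose E (p : 'I_N * 'I_N) : set Omega :=
  if p.1 != p.2 then [set w | forall n j, pair_event s p.1 p.2 (r w) n j (U n j w)]
  else set0.
have mE p : measurable (E p).
  rewrite /E; case: ifP => // _.
  apply: (measurable_perms H (Q := fun q => [set w | forall n j, pair_event s p.1 p.2 q n j (U n j w)])) => q.
  apply: measurable_noise_event => n j.
  by rewrite /pair_event; case: ifP => // _; case: ifP.
have mA : measurable [set w | (separation (X w) < (s / N%:R)%:E)%E].
  have := emeasurable_fun_infty_o measurableT (measurable_separation H) (s / N%:R)%:E.
  by rewrite setTI.
apply: le_trans (prob_unit_le mA) _.
apply: le_trans (@union_bound _ _ _ P _ _ E _ mE _) _.
- by apply: measurableI => //; exact: measurable_unit_event.
- move=> w [/separation_ltP[i [k [ik xik]]] Uw]; exists (i, k) => //.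
  rewrite /E/=.
  have nik : i != k by rewrite -val_eqE neq_ltn ik.
  rewrite nik => n j; rewrite /pair_event; case: ifP => [/eqP ->|//].
  have : `|(X w i - X w k) ord0 j| <= s / N%:R.
    by have /sup_norm_leP := ltW xik; apply; rewrite divr_ge0 // ltW.
  have -> : (X w i - X w k) ord0 j = X w i ord0 j - X w k ord0 j by rewrite !mxE.
  rewrite !sample_coord -mulrBl normrM [`|_^-1|]ger0_norm ?invr_ge0 ?(ltW N_R)//.
  rewrite ler_pM2r ?invr_gt0// ler_norml => /andP[h1 h2].
  have /andP[u0 u1] := Uw i j; have /andP[v0 v1] := Uw k j.
  case: ltnP => ab; rewrite /= in_itv/= ?andbT.
    have -> : (r w j i - r w j k)%N = 0%N by apply/eqP; rewrite subn_eq0 ltnW.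
    by rewrite add0n natrB ?(ltnW ab)//; lra.
  have -> : (r w j k - r w j i)%N = 0%N by apply/eqP; rewrite subn_eq0.
  by rewrite addn0 natrB//; lra.
apply: (@le_trans _ _ (\sum_(p : 'I_N * 'I_N) (((s + s) / N.-1%:R) ^+ d)%:E)%E).
  apply: lee_sum => -[i k] _; rewrite /E/=; case: ifPn => [ik|_].
    exact: pair_event_prob.
  by rewrite measure0 lee_fin exprn_ge0// divr_ge0// addr_ge0.
rewrite sumEFin lee_fin sumr_const card_prod !card_ord -[_ *+ _]mulr_natl.
by rewrite natrM expr2.
Qed.
End Events.

(** * Probabilities of extreme covering radii *)

Section Blocks.
Variables (N l : nat).

Definition block (k : nat) : {set 'I_N} := [set v : 'I_N | (v %/ l == k)%N]%SET.

Lemma blockP k (v : 'I_N) : (0 < l)%N ->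
  (v \in block k) = (k * l <= v < k.+1 * l)%N.
Proof.
by move=> l0; rewrite inE eqn_leq leq_divRL// andbC -[(v %/ l <= k)%N]ltnS ltn_divLR.
Qed.

Lemma block_disjoint k k' : k != k' -> [disjoint block k & block k']%B.
Proof.
move=> kk'; rewrite -setI_eq0; apply/eqP/setP => v; rewrite !inE.
by apply/negP => /andP[/eqP -> /eqP e]; rewrite e eqxx in kk'.
Qed.

Lemma card_block k : (0 < l)%N -> (k.+1 * l <= N)%N -> #|block k| = l.
Proof.
move=> l0 kN; rewrite -sum1_card big_mkcond/=.
rewrite (eq_bigr (fun i : 'I_N => nat_of_bool (k * l <= i < k.+1 * l)%N)); last first.
  by move=> i _; rewrite blockP//; case: (_ && _).
have e : (k.+1 * l - k * l = l)%N by rewrite mulSn addnK.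
apply/eqP; rewrite eqn_leq; apply/andP; split.
  apply: leq_trans (@count_interval_le (fun i => k * l <= i < k.+1 * l)%N (k * l) (k.+1 * l) N _) _ => //.
  by rewrite e.
rewrite -[leqLHS]e.
by apply: (@count_interval_ge (fun i => k * l <= i < k.+1 * l)%N).
Qed.
End Blocks.

Lemma covering_le (R : realType) d N (x : 'I_N -> 'rV[R]_d) (t : R) :
    (forall z, unit_cube R d z -> exists n, `|z - x n| <= t) ->
  (covering_radius x <= t%:E)%E.
Proof.
move=> h; rewrite leNgt; apply/negP => /covering_gtP[z zu tz].
by have [n] := h z zu; rewrite leNgt tz.
Qed.

Lemma covering_ge (R : realType) d N (x : 'I_N -> 'rV[R]_d) (t : R) z :
  unit_cube R d z -> (forall n, t <= `|z - x n|) ->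
  (t%:E <= covering_radius x)%E.
Proof.
move=> zu h; apply: le_ereal_sup_tmp; eexists; first by exists z.
by apply: le_bigmin => [|n _]; rewrite ?leey ?lee_fin.
Qed.

Section Events.
Variables (R : realType) (dO : measure_display) (Omega : measurableType dO).
Variables (P : probability Omega R) (d N : nat).
Variables (perm : 'I_d -> Omega -> 'S_N) (U : 'I_N -> 'I_d -> {RV P >-> R}).
Hypothesis H : lhs_randomness perm U.
Local Notation W := {ffun 'I_d -> 'S_N}.
Local Notation X := (lhs_sample perm U).
Local Notation r := (perms perm).
Hypothesis N_gt0 : (0 < N)%N.
Let N_R : 0 < N%:R :> R. Proof. by rewrite ltr0n. Qed.

(** A point of the cube lies in a block of [m + m] cells or, when it is beyond
    the last full block, at most one block away from it; a sample point in that
    block is at distance at most two blocks. *)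
Lemma covering_large_prob m (b t : R) (j0 : 'I_d) :
    (0 < m)%N -> (m + m <= N)%N ->
    b <= 1 -> b * N%:R ^+ d.-1 <= m%:R ^+ d.-1 ->
    4 * m%:R / N%:R <= t ->
  (P [set w | t%:E < covering_radius (X w)] <=
   (N%:R ^+ d * (1 - b) ^+ m)%:E)%E.
Proof.
move=> m0 mN b1 bm mt; set l := (m + m)%N; set L := (N %/ l)%N.
have l0 : (0 < l)%N by rewrite /l addn_gt0 m0.
have L0 : (0 < L)%N by rewrite divn_gt0.
have LN : (L * l <= N)%N by exact: leq_trunc_div.
have NL : (N < L.+1 * l)%N by exact: ltn_ceil.
pose B (c : {ffun 'I_d -> 'I_L}) (j : 'I_d) := block N l (c j).
apply: le_trans (prob_perms_le H (Q := fun s => [exists c, ~~ box_hit (B c) s]) _ _) _.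
- have := emeasurable_fun_o_infty measurableT (measurable_covering H) t%:E.
  by rewrite setTI.
- move=> w Uw; apply: contraTT; rewrite negb_exists => /forallP hit.
  rewrite -leNgt; apply/covering_le => z zu.
  (* beyond the last full block, the minimum falls back on that block *)
  have cL (j : 'I_d) : (minn (Num.trunc (z ord0 j * N%:R) %/ l) L.-1 < L)%N.
    by rewrite gtn_min prednK// leqnn orbT.
  pose c : {ffun 'I_d -> 'I_L} := [ffun j => Ordinal (cL j)].
  have := hit c; rewrite negbK => /existsP[n /forallP hn]; exists n.
  apply/sup_norm_leP; first by rewrite (le_trans _ mt)// divr_ge0// mulr_ge0.
  move=> j; have := hn j; rewrite /B blockP// ffunE/=.
  set a := minn _ _ => /andP[h1 h2].
  have -> : (z - X w n) ord0 j = z ord0 j - X w n ord0 j by rewrite !mxE.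
  have /andP[z0 z1] := zu j.
  have zN0 : 0 <= z ord0 j * N%:R by rewrite mulr_ge0.
  have zN1 : z ord0 j * N%:R <= N%:R by rewrite ger_pMl.
  have a1 : (a * l)%:R <= z ord0 j * N%:R.
    apply: (@le_trans _ _ (Num.trunc (z ord0 j * N%:R))%:R); last first.
      by rewrite truncn_le.
    rewrite ler_nat (leq_trans _ (leq_trunc_div _ l))// leq_mul2r geq_minl.
    by rewrite orbT.
  have a2 : z ord0 j * N%:R <= (a.+2 * l)%:R.
    rewrite /a; case: leqP => _.
      apply: (@le_trans _ _ (Num.trunc (z ord0 j * N%:R)).+1%:R).
        exact: ltW (truncnS_gt _).
      rewrite ler_nat; apply: leq_trans (ltn_ceil _ l0) _.
      by rewrite leq_mul2r leqnSn orbT.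
    apply: le_trans zN1 _; rewrite ler_nat prednK//.
    exact: ltnW.
  have -> : z ord0 j - X w n ord0 j =
      (z ord0 j * N%:R - ((r w j n)%:R + U n j w)) / N%:R.
    by rewrite sample_coord mulrBl mulfK// gt_eqF.
  rewrite normrM [`|_^-1|]ger0_norm ?invr_ge0 ?(ltW N_R)//.
  apply: le_trans mt; rewrite ler_wpM2r ?invr_ge0 ?(ltW N_R)//.
  have /andP[u0 u1] := Uw n j.
  have lR : l%:R = m%:R + m%:R :> R by rewrite natrD.
  have h1R : (a * l)%:R <= (r w j n)%:R :> R by rewrite ler_nat.
  have h2R : (r w j n)%:R + 1 <= (a.+1 * l)%:R :> R by rewrite natr1 ler_nat.
  have e1 : (a.+1 * l)%:R = (a * l)%:R + l%:R :> R by rewrite mulSn addnC natrD.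
  have e2 : (a.+2 * l)%:R = (a * l)%:R + l%:R + l%:R :> R.
    by rewrite !mulSn !natrD; ring.
  rewrite ler_norml; apply/andP; split; lra.
rewrite lee_fin.
have h1 : mean (fun s : W => ([exists c, ~~ box_hit (B c) s])%:R) <=
    mean (fun s : W => \sum_c (~~ box_hit (B c) s)%:R) :> R.
  apply: ler_mean => s; case: existsP => [[c hc]|_]; last by rewrite sumr_ge0.
  by rewrite (bigD1 c)//= hc lerDl sumr_ge0.
apply: le_trans h1 _; rewrite mean_sum.
have b1' : 0 <= (1 - b) ^+ m by rewrite exprn_ge0// subr_ge0.
apply: (@le_trans _ _ (\sum_(c : {ffun 'I_d -> 'I_L}) (1 - b) ^+ m)).
  apply: ler_sum => c _; apply: (mean_box_missed_le j0) => // j.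
  rewrite card_block//; apply: leq_trans LN; rewrite leq_mul2r.
  by rewrite ltn_ord orbT.
rewrite sumr_const card_ffun !card_ord -[_ *+ _]mulr_natl ler_wpM2r//.
by rewrite natrX lerXn2r ?nnegrE// ler_nat leq_div.
Qed.

(** The center of an empty box of side [l / N] is at distance at least
    [l / (2 N)] from the sample. *)
Lemma covering_small_prob l M m (b t : R) (j0 : 'I_d) :
    (0 < l)%N -> (0 < m)%N -> (M * l + m <= N)%N ->
    0 <= b <= 1 -> l%:R ^+ d.-1 <= b * m%:R ^+ d.-1 ->
    t <= l%:R / (2 * N%:R) ->
  (P [set w | covering_radius (X w) < t%:E] <=
   ((1 - (1 - b) ^+ l) ^+ M)%:E)%E.
Proof.
move=> l0 m0 MN b01 lb tl.
apply: le_trans (prob_perms_le H (Q := fun s =>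
  [forall k : 'I_M, box_hit (fun=> block N l k) s]) _ _) _.
- have := emeasurable_fun_infty_o measurableT (measurable_covering H) t%:E.
  by rewrite setTI.
- move=> w Uw; apply: contraTT; rewrite negb_forall => /existsP[k miss].
  rewrite -leNgt.
  have kN : (k.+1 * l <= N)%N.
    apply: leq_trans MN; apply: leq_trans (leq_addr _ _).
    by rewrite leq_mul2r ltn_ord orbT.
  have lR : 0 < l%:R :> R by rewrite ltr0n.
  pose z : 'rV[R]_d := \row_j (((k * l)%:R + l%:R / 2) / N%:R).
  have kNR : (k * l)%:R + l%:R <= N%:R :> R.
    by rewrite -natrD ler_nat addnC -mulSn.
  apply: (@covering_ge _ _ _ _ _ z).
    move=> j; rewrite mxE divr_ge0 ?addr_ge0 ?divr_ge0//= ler_pdivrMr// mul1r.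
    by apply: le_trans kNR; lra.
  move=> n; move: miss; rewrite negb_exists => /forallP/(_ n).
  rewrite negb_forall => /existsP[j]; rewrite blockP// => nj.
  apply: (@le_trans _ _ `|(z - X w n) ord0 j|); last first.
    by have /sup_norm_leP := lexx `|z - X w n|; apply.
  apply: le_trans tl _.
  have -> : (z - X w n) ord0 j = z ord0 j - X w n ord0 j by rewrite !mxE.
  rewrite sample_coord mxE -mulrBl normrM [`|_^-1|]ger0_norm ?invr_ge0 ?(ltW N_R)//.
  rewrite invfM mulrA ler_wpM2r ?invr_ge0 ?(ltW N_R)//.
  have /andP[u0 u1] := Uw n j.
  rewrite ler_normr; move: nj; rewrite negb_and -!ltnNge ltnS => /orP[h|h].
    have hR : (r w j n)%:R + 1 <= (k * l)%:R :> R by rewrite natr1 ler_nat.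
    by apply/orP; left; lra.
  have hR : (k * l)%:R + l%:R <= (r w j n)%:R :> R.
    by rewrite -natrD ler_nat addnC -mulSn.
  by apply/orP; right; lra.
rewrite lee_fin; apply: (@mean_all_hit_le _ _ _ j0 (block N l) M l m b) => //.
  by move=> k k'; exact: block_disjoint.
move=> k kM; apply: card_block => //.
apply: leq_trans MN; apply: leq_trans (leq_addr _ _).
by rewrite leq_mul2r kM orbT.
Qed.
End Events.

(** * Tail bounds at the right scale *)

Lemma expR_sub1_le (R : realType) (x : R) n : x <= 1 -> (1 - x) ^+ n <= expR (- (n%:R * x)).
Proof.
move=> x1; rewrite -mulrN expRM_natl lerXn2r ?nnegrE ?subr_ge0 ?expR_ge0//.
exact: expR_ge1Dx.
Qed.

Lemma expR_sub1_ge (R : realType) (x : R) : 0 <= x <= 2^-1 ->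
  expR (- (2 * x)) <= 1 - x.
Proof.
move=> /andP[x0 x1]; rewrite expRN -[leRHS]invrK.
have h : 0 < 1 - x by lra.
rewrite lef_pV2 ?posrE ?expR_gt0 ?invr_gt0//.
apply: le_trans (expR_ge1Dx (2 * x)).
rewrite -[leLHS]mul1r ler_pdivrMr//; nra.
Qed.

Lemma expRN_le_inv (R : realType) (x : R) : 0 < x -> expR (- x) <= x^-1.
Proof.
move=> x0; rewrite expRN lef_pV2 ?posrE ?expR_gt0//.
by apply: le_trans (expR_ge1Dx x); lra.
Qed.

Lemma sqr_le_expR (R : realType) (x : R) : 0 <= x -> (x / 2) ^+ 2 <= expR x.
Proof.
move=> x0; have -> : x = 2%:R * (x / 2) by field.
rewrite [in leRHS]expRM_natl; rewrite mulrAC divff// mul1r.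
rewrite lerXn2r ?nnegrE ?expR_ge0 ?divr_ge0//.
by apply: le_trans (expR_ge1Dx _); lra.
Qed.

Lemma expr_le_base (R : realFieldType) (x : R) n : (0 < n)%N -> 0 <= x <= 1 ->
  x ^+ n <= x.
Proof.
case: n => // n _ /andP[x0 x1].
by rewrite exprS ler_piMr// exprn_ile1.
Qed.

Lemma trunc_ge_half (R : realType) (y : R) : 1 <= y ->
  y / 2 <= (Num.trunc y)%:R.
Proof.
move=> y1; have := truncnS_gt y; rewrite -natr1 => h.
have : 1 <= (Num.trunc y)%:R :> R.
  by rewrite ler1n truncn_gt0.
lra.
Qed.

Section Asymptotics.
Variables (R : realType) (dO : measure_display) (Omega : measurableType dO).
Variables (P : probability Omega R) (d N : nat).
Variables (perm : 'I_d -> Omega -> 'S_N) (U : 'I_N -> 'I_d -> {RV P >-> R}).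
Hypothesis H : lhs_randomness perm U.
Local Notation W := {ffun 'I_d -> 'S_N}.
Local Notation X := (lhs_sample perm U).
Hypotheses (d_ge2 : (2 <= d)%N) (N_ge2 : (2 <= N)%N).
Let N_gt0 : (0 < N)%N. Proof. exact: leq_trans N_ge2. Qed.
Let d_gt0 : (0 < d)%N. Proof. exact: leq_trans d_ge2. Qed.
Let N_R : 0 < N%:R :> R. Proof. by rewrite ltr0n. Qed.

Let exprd1 (z : R) : z ^+ d = z * z ^+ d.-1.
Proof. by rewrite -exprS prednK. Qed.

(** Here [a] is [N ^ (- 2 / d)], and closeness is measured with
    [m = trunc (C a N) - 1] cells, between [C a N / 2] and [C a N]; the mean number
    of close pairs is then at least of order [(C / 2) ^ d]. *)
Lemma separation_upper (C a : R) : 0 < a -> a ^+ d * N%:R ^+ 2 = 1 -> 4 <= C ->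
    (2 * C) ^+ d <= N%:R -> (12 * d <= N)%N ->
  (P [set w | (C * a)%:E < separation (X w)] <=
   ((12 * d%:R + 6 * 4 ^+ d) / N%:R + 9 * (2 / C))%:E)%E.
Proof.
move=> a0 aN C4 CN dN.
have C0 : 0 < C by lra.
have N1 : 1 <= N%:R :> R by rewrite ler1n.
have aN1 : 1 <= a * N%:R.
  rewrite -(ler_pXn2r d_gt0) ?nnegrE ?mulr_ge0 ?(ltW a0)// expr1n exprMn.
  have -> : N%:R ^+ d = N%:R ^+ (d - 2) * N%:R ^+ 2 :> R.
    by rewrite -exprD subnK.
  rewrite mulrCA aN mulr1.
  by rewrite exprn_ege1.
have CaN : 4 <= C * a * N%:R by rewrite -mulrA; nra.
set T := Num.trunc (C * a * N%:R).
have T1 : T%:R <= C * a * N%:R by rewrite truncn_le; lra.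
have T4 : (4 <= T)%N by rewrite truncn_ge_nat; lra.
have T2 : C * a * N%:R < T%:R + 1 by rewrite natr1 truncnS_gt.
have T0 : (0 < T)%N by exact: leq_trans T4.
have TE : T.-1.+1 = T by rewrite prednK.
have mE : T.-1%:R = T%:R - 1 :> R by rewrite -subn1 natrB.
have Ca1 : 2 * C * a <= 1.
  rewrite -(ler_pXn2r d_gt0) ?nnegrE ?mulr_ge0 ?(ltW a0) ?(ltW C0)//.
  rewrite expr1n exprMn -[leRHS]aN mulrC ler_wpM2l ?exprn_ge0 ?(ltW a0)//.
  by apply: le_trans CN _; rewrite expr2 ler_peMl// ltW.
apply: le_trans (separation_large_prob H N_gt0 (m := T.-1) _) _.
  by rewrite TE ler_pdivrMr.
rewrite lee_fin; apply: le_trans (mean_no_close_pair_le _ _ _ d_gt0 dN) _.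
- by rewrite -ltnS TE; exact: leq_trans T4.
- have : T%:R + T%:R <= N%:R :> R by nra.
  rewrite -natrD ler_nat; apply: leq_trans.
  by rewrite leq_add// leq_pred.
rewrite lerD2l -mulrA ler_wpM2l//.
have m0 : 0 < T.-1%:R :> R by rewrite ltr0n -ltnS TE; exact: leq_trans T4.
have h : N%:R / T.-1%:R <= 2 / C / a.
  rewrite ler_pdivrMr// mulrAC ler_pdivlMr// mulrAC ler_pdivlMr//.
  by rewrite mE; nra.
apply: (@le_trans _ _ ((2 / C / a) ^+ d / N%:R ^+ 2)).
  rewrite ler_wpM2r ?invr_ge0 ?exprn_ge0//.
  by rewrite lerXn2r ?nnegrE ?divr_ge0 ?(ltW a0) ?(ltW C0).
rewrite [(2 / C / a) ^+ d]exprMn exprVn -mulrA -invfM aN invr1 mulr1.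
apply: expr_le_base => //; rewrite divr_ge0 ?(ltW C0)//= ler_pdivrMr//; lra.
Qed.

(** With [s = N a / C] the union bound is at most
    [N ^ 2 (4 a / C) ^ d = (4 / C) ^ d]. *)
Lemma separation_lower (C a : R) : 0 < a -> a ^+ d * N%:R ^+ 2 = 1 -> 4 <= C ->
  (P [set w | separation (X w) < (a / C)%:E] <= (4 / C)%:E)%E.
Proof.
move=> a0 aN C4; have C0 : 0 < C by lra.
have -> : a / C = (N%:R * a / C) / N%:R by field; rewrite !gt_eqF.
have s0 : 0 <= N%:R * a / C by rewrite divr_ge0 ?mulr_ge0 ?(ltW a0) ?(ltW C0).
apply: le_trans (separation_small_prob H N_gt0 s0) _.
have Np : N.-1%:R = N%:R - 1 :> R by rewrite -subn1 natrB.
have N2 : 2 <= N%:R :> R by rewrite (ler_nat R 2).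
have h : (N%:R * a / C + N%:R * a / C) / N.-1%:R <= 4 / C * a.
  rewrite Np ler_pdivrMr; last by lra.
  have -> : N%:R * a / C + N%:R * a / C = a / C * (2 * N%:R) by field; rewrite gt_eqF.
  have -> : 4 / C * a * (N%:R - 1) = a / C * (4 * (N%:R - 1)) by field; rewrite gt_eqF.
  by rewrite ler_wpM2l ?divr_ge0 ?(ltW a0) ?(ltW C0)//; lra.
rewrite lee_fin.
apply: (@le_trans _ _ (N%:R ^+ 2 * (4 / C * a) ^+ d)).
  rewrite ler_wpM2l ?exprn_ge0// lerXn2r ?nnegrE//.
    by rewrite divr_ge0 ?addr_ge0.
  by rewrite mulr_ge0 ?divr_ge0 ?(ltW a0) ?(ltW C0).
rewrite exprMn mulrCA [X in _ * X]mulrC aN mulr1.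
apply: expr_le_base => //; rewrite divr_ge0 ?(ltW C0)//= ler_pdivrMr//; lra.
Qed.

(** Here [a] is [(ln N / N) ^ (1 / d)].  With [m] about [C a N / 8] at least, the
    exponent [m ^ d / N ^ (d - 1)] is at least [(d + 1) ln N]: the boxes, at most
    [N ^ d], are all hit except with probability [1 / N]. *)
Lemma covering_upper (C a : R) : 0 < a -> a ^+ d * N%:R = ln N%:R ->
    1 <= ln N%:R :> R -> C = 8 * d.+1%:R -> C * a <= 2 ->
  (P [set w | (C * a)%:E < covering_radius (X w)] <= (N%:R^-1)%:E)%E.
Proof.
move=> a0 aN L1 CE Ca2.
have d1 : 2 <= d.+1%:R :> R by rewrite (ler_nat R 2) ltnS.
have C0 : 0 < C by lra.
have N1 : 1 <= N%:R :> R by rewrite ler1n.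
have aN1 : 1 <= a * N%:R.
  rewrite -(ler_pXn2r d_gt0) ?nnegrE ?mulr_ge0 ?(ltW a0)// expr1n exprMn.
  rewrite [N%:R ^+ d]exprd1 mulrA aN.
  by rewrite mulr_ege1// exprn_ege1.
have y1 : 1 <= C * a * N%:R / 4 by rewrite ler_pdivlMr// mul1r -mulrA; nra.
set m := Num.trunc (C * a * N%:R / 4).
have m_le : m%:R <= C * a * N%:R / 4 by rewrite truncn_le; lra.
have m_ge : C * a * N%:R / 8 <= m%:R.
  by have := trunc_ge_half y1; rewrite -/m; lra.
have m0 : (0 < m)%N by rewrite truncn_gt0.
have mN : (m + m <= N)%N.
  by rewrite -(ler_nat R) natrD; nra.
have mNR : m%:R <= N%:R :> R.
  by rewrite ler_nat (leq_trans _ mN)// leq_addr.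
pose b : R := (m%:R / N%:R) ^+ d.-1.
have mN01 : 0 <= (m%:R / N%:R : R) <= 1.
  by rewrite divr_ge0//= ler_pdivrMr// mul1r.
have b1 : b <= 1 by apply: exprn_ile1; case/andP: mN01.
have [j0] : exists j0 : 'I_d, True by exists (Ordinal d_gt0).
move=> _; apply: le_trans (covering_large_prob H N_gt0 j0 m0 mN b1 _ _) _.
- by rewrite /b -exprMn divfK// gt_eqF.
- by rewrite ler_pdivrMr//; lra.
rewrite lee_fin.
have h : d.+1%:R * ln N%:R <= m%:R * b.
  apply: (@le_trans _ _ ((C * a / 8) ^+ d * N%:R)).
    have -> : C * a / 8 = d.+1%:R * a by rewrite CE; field.
    rewrite exprMn -mulrA aN ler_wpM2r//; first by lra.
    by apply: ler_eXnr => //; lra.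
  have -> : m%:R * b = (m%:R / N%:R) ^+ d * N%:R.
    rewrite /b exprd1 [RHS]mulrC mulrA.
    by congr (_ * _); rewrite mulrC divfK// gt_eqF.
  rewrite ler_wpM2r//.
  rewrite lerXn2r ?nnegrE ?divr_ge0 ?mulr_ge0 ?(ltW C0) ?(ltW a0)//.
  by rewrite ler_pdivlMr//; lra.
apply: (@le_trans _ _ (N%:R ^+ d * expR (- (d.+1%:R * ln N%:R)))).
  rewrite ler_wpM2l ?exprn_ge0 ?(ltW N_R)//.
  apply: le_trans (expR_sub1_le _ b1) _.
  by rewrite ler_expR lerN2.
rewrite expRN expRM_natl lnK ?posrE// exprSr invfM mulrA divff ?mul1r//.
by rewrite gt_eqF// exprn_gt0.
Qed.

(** With [k = 1 / (8 d)] and boxes of side [l], about [k a N], a box is missed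
    with conditional probability at least [N ^ (- 1 / (4 d))], while there are at
    least [1 / (4 k a)] diagonal boxes in the first half of the cells.  The product
    of the two numbers is [y], and [y ^ d] is at least [ln N / 16]. *)
Lemma covering_lower (eps a : R) : 0 < eps -> 0 < a -> a ^+ d * N%:R = ln N%:R ->
    1 <= ln N%:R :> R -> (8 * d%:R) ^+ d <= N%:R :> R ->
    16 / eps ^+ d <= ln N%:R ->
  (P [set w | covering_radius (X w) < (a / (32 * d%:R))%:E] <= eps%:E)%E.
Proof.
move=> e0 a0 aN L1 dN Le.
have d2 : 2 <= d%:R :> R by rewrite (ler_nat R 2).
(* chosen so that (2 k) ^ d <= 2 k = 1 / (4 d) *)
pose k : R := (8 * d%:R)^-1.
have k0 : 0 < k by rewrite invr_gt0; lra.
have kd : k * (8 * d%:R) = 1 by rewrite mulVf// gt_eqF//; lra.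
have N1 : 1 <= N%:R :> R by rewrite ler1n.
have a1 : a <= 1.
  rewrite -(ler_pXn2r d_gt0) ?nnegrE ?(ltW a0)// expr1n.
  rewrite -(ler_pM2r N_R) aN mul1r.
  have := expR_ge1Dx (ln N%:R : R); rewrite lnK ?posrE//; lra.
have y1 : 1 <= k * a * N%:R.
  rewrite -(ler_pXn2r d_gt0) ?nnegrE ?mulr_ge0 ?(ltW a0) ?(ltW k0) ?(ltW N_R)//.
  rewrite expr1n !exprMn -mulrA [N%:R ^+ d]exprd1.
  rewrite [a ^+ d * _]mulrA aN.
  have kN : 1 <= k ^+ d * N%:R.
    by rewrite /k exprVn mulrC ler_pdivlMr ?mul1r// exprn_gt0//; lra.
  have Nd : N%:R <= N%:R ^+ d.-1 :> R.
    by apply: ler_eXnr => //; rewrite -ltnS prednK.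
  apply: le_trans kN _; rewrite ler_wpM2l ?exprn_ge0 ?(ltW k0)//.
  by apply: le_trans Nd _; rewrite ler_peMl// exprn_ge0// ltW.
set l := Num.trunc (k * a * N%:R).
have l_le : l%:R <= k * a * N%:R by rewrite truncn_le; lra.
have l_ge : k * a * N%:R / 2 <= l%:R by exact: trunc_ge_half.
have l0 : (0 < l)%N by rewrite truncn_gt0.
have l0R : 0 < l%:R :> R by rewrite ltr0n.
have k16 : k <= 16^-1.
  by rewrite lef_pV2 ?posrE//; lra.
have ka16 : k * a <= 16^-1.
  by apply: le_trans k16; rewrite ler_piMr// ltW.
have l4 : 4 * l%:R <= N%:R :> R.
  have : k * a * N%:R <= 16^-1 * N%:R by rewrite ler_wpM2r// ltW.
  by lra.
(* M boxes of l cells fill at most half of the cells; the m others stay free *)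
pose M := (N %/ l.*2)%N; pose m := (N - N./2)%N.
have l20 : (0 < l.*2)%N by rewrite double_gt0.
have l2N : (l.*2 <= N)%N.
  by rewrite -(ler_nat R) -addnn natrD; lra.
have M0 : (0 < M)%N by rewrite divn_gt0.
have Ml : (M * l.*2 <= N)%N by exact: leq_trunc_div.
have MlN : (M * l + m <= N)%N.
  by move: Ml; rewrite /m -doubleMr; move: (M * l)%N => n; clear; lia.
have MR : N%:R / (4 * l%:R) <= M%:R :> R.
  rewrite ler_pdivrMr; last by rewrite mulr_gt0.
  have : (N < M.+1 * l.*2)%N by exact: ltn_ceil.
  rewrite -(ltr_nat R) natrM -natr1 -addnn natrD => h.
  have M1 : 1 <= M%:R :> R by rewrite ler1n.
  nra.
have mR : N%:R <= 2 * m%:R :> R.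
  by rewrite -natrM ler_nat /m; clear; lia.
have m0 : (0 < m)%N by move: N_gt0; rewrite /m; clear; lia.
pose x : R := 2 * l%:R / N%:R.
have x0 : 0 <= x by rewrite divr_ge0 ?mulr_ge0 ?(ltW N_R).
have xk : x <= 2 * k * a by rewrite ler_pdivrMr//; lra.
have x12 : x <= 2^-1 by rewrite ler_pdivrMr//; lra.
pose b : R := x ^+ d.-1.
have bx : b <= x.
  by apply: expr_le_base; [rewrite -ltnS prednK|rewrite x0/=; lra].
have b0 : 0 <= b by exact: exprn_ge0.
have [j0] : exists j0 : 'I_d, True by exists (Ordinal d_gt0).
move=> _; apply: le_trans (covering_small_prob H N_gt0 (b := b) j0 l0 m0 MlN _ _ _) _.
- by rewrite b0/=; lra.
- rewrite /b -exprMn lerXn2r ?nnegrE ?mulr_ge0//.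
  by rewrite /x mulrAC ler_pdivlMr//; nra.
- rewrite ler_pdivlMr ?mulr_gt0//.
  have -> : a / (32 * d%:R) = k * a / 4 by rewrite /k; field; lra.
  by lra.
rewrite lee_fin.
pose q : R := (1 - b) ^+ l.
have bl : l%:R * b <= ln N%:R / (8 * d%:R).
  have -> : l%:R * b = x ^+ d * N%:R / 2.
    rewrite /b exprd1 {2}/x.
    by field; rewrite gt_eqF.
  rewrite ler_pdivrMr//.
  apply: (@le_trans _ _ ((2 * k * a) ^+ d * N%:R)).
    rewrite ler_wpM2r ?(ltW N_R)// lerXn2r ?nnegrE//.
    by rewrite !mulr_ge0 ?(ltW k0) ?(ltW a0).
  rewrite exprMn -mulrA aN.
  have -> : ln N%:R / (8 * d%:R) * 2 = 2 * k * ln N%:R :> R by rewrite /k; field; lra.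
  rewrite ler_wpM2r//; first by lra.
  by apply: expr_le_base => //; lra.
have qe : expR (- (ln N%:R / (4 * d%:R))) <= q.
  apply: (@le_trans _ _ (expR (- (2 * b)) ^+ l)).
    rewrite -expRM_natl ler_expR mulrN lerN2.
    have -> : l%:R * (2 * b) = 2 * (l%:R * b) by ring.
    have -> : ln N%:R / (4 * d%:R) = 2 * (ln N%:R / (8 * d%:R)) :> R by field; lra.
    by rewrite ler_wpM2l.
  rewrite lerXn2r ?nnegrE ?expR_ge0 ?subr_ge0//; first by lra.
  by apply: expR_sub1_ge; rewrite b0/=; lra.
have q1 : q <= 1 by apply: exprn_ile1; lra.
apply: le_trans (expR_sub1_le _ q1) _.
pose y : R := expR (- (ln N%:R / (4 * d%:R))) / (4 * k * a).
have ka0 : 0 < 4 * k * a by rewrite !mulr_gt0.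
have y0 : 0 < y by rewrite divr_gt0// expR_gt0.
have yM : y <= M%:R * q.
  rewrite mulrC ler_pM ?expR_ge0 ?invr_ge0 ?(ltW ka0)//.
  apply: le_trans MR; rewrite -[leLHS]mul1r ler_pdivrMr// mulrAC.
  by rewrite ler_pdivlMr ?mulr_gt0//; nra.
apply: (@le_trans _ _ (expR (- y))); first by rewrite ler_expR lerN2.
apply: le_trans (expRN_le_inv y0) _.
rewrite -[leRHS]invrK lef_pV2 ?posrE ?invr_gt0//.
rewrite -(ler_pXn2r d_gt0) ?nnegrE ?invr_ge0 ?(ltW e0) ?(ltW y0)//.
rewrite exprVn.
apply: (@le_trans _ _ (ln N%:R / 16)).
  by rewrite ler_pdivlMr// mulrC.
rewrite /y exprMn -expRM_natl exprVn.
have -> : d%:R * - (ln N%:R / (4 * d%:R)) = - (ln N%:R / 4) :> R by field; lra.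
rewrite ler_pdivlMr ?exprn_gt0//.
rewrite [(4 * k * a) ^+ d]exprMn mulrA.
apply: (@le_trans _ _ (ln N%:R / 16 * a ^+ d)).
  rewrite ler_wpM2r ?exprn_ge0 ?(ltW a0)// ler_piMr//; first by lra.
  by apply: exprn_ile1; lra.
rewrite -(ler_pM2r N_R) -[leLHS]mulrA aN.
have -> : expR (- (ln N%:R / 4)) * N%:R = expR (3 / 4 * ln N%:R) :> R.
  rewrite -[X in _ * X](lnK (_ : N%:R \is Num.pos)) ?posrE// -expRD.
  by congr expR; field.
move: (ln N%:R : R) L1 => L L1.
apply: (@le_trans _ _ ((L / 4) ^+ 2)); first by nra.
have -> : L / 4 = L / 2 / 2 by field.
have L0 : 0 <= L / 2 by lra.
apply: le_trans (sqr_le_expR L0) _.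
by rewrite ler_expR; lra.
Qed.
End Asymptotics.

(** * Orders in probability *)

Lemma eventually_ln_ge (R : realType) (K : R) : exists N0, forall N, (N0 <= N)%N ->
  [/\ (2 <= N)%N, K <= N%:R :> R & K <= ln N%:R].
Proof.
exists (maxn 2 (Num.trunc (expR K)).+1) => N; rewrite geq_max => /andP[N2 NK].
have h : expR K <= N%:R.
  by apply: le_trans (ltW (truncnS_gt _)) _; rewrite ler_nat.
split => //; first by apply: le_trans h; have := expR_ge1Dx K; lra.
by rewrite -[K]expRK ler_ln// posrE ?expR_gt0// ltr0n (leq_trans _ N2).
Qed.

Lemma powR_rootK (R : realType) (x : R) d : (0 < d)%N -> 0 <= x ->
  (x `^ d%:R^-1) ^+ d = x.
Proof.
move=> d0 x0; rewrite -powR_mulrn ?powR_ge0// -powRrM mulVf ?powRr1//.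
by rewrite pnatr_eq0 -lt0n.
Qed.

Lemma powR_sep_scale (R : realType) d N : (0 < d)%N -> (0 < N)%N ->
  (N%:R `^ (- (2 / d%:R))) ^+ d * N%:R ^+ 2 = 1 :> R.
Proof.
move=> d0 N0; rewrite -powR_mulrn ?powR_ge0// -powRrM mulNr divfK; last first.
  by rewrite pnatr_eq0 -lt0n.
by rewrite powR_invn// mulVf// expf_neq0// pnatr_eq0 -lt0n.
Qed.

(** The convention [0^-1 = +oo] makes the equality hold for [x = 0] too. *)
Lemma abse_ratio_gt (R : realType) (C a : R) (x : \bar R) :
  0 < C -> 0 < a -> (0 <= x)%E ->
  (C%:E < `|a%:E / x|)%E = (x < (a / C)%:E)%E.
Proof.
move=> C0 a0; case: x => [x| |]//; last first.
  by move=> _; rewrite invey mule0 abse0 lte_fin ltNge (ltW C0) ltNge leey.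
rewrite lee_fin => x0; rewrite inver; have [->|xn0] := eqVneq x 0.
  by rewrite mulry gtr0_sg// mul1e /= ltry lte_fin divr_gt0.
have xp : 0 < x by rewrite lt_neqAle eq_sym xn0.
rewrite -EFinM abse_EFin !lte_fin ger0_norm ?divr_ge0 ?(ltW a0)//.
by rewrite ltr_pdivlMr// mulrC ltr_pdivlMr// mulrC.
Qed.

Lemma bigTheta_of_tails (R : realType) (dO : nat -> measure_display)
    (Omega : forall N, measurableType (dO N))
    (P : forall N, probability (Omega N) R)
    (X : forall N, Omega N -> \bar R) (a : nat -> R) :
    (forall N w, (0 <= X N w)%E) ->
    (forall N, (2 <= N)%N -> 0 < a N) ->
    (forall eps : R, 0 < eps -> exists2 C : R, 0 < C &
      exists N0, forall N, (N0 <= N)%N ->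
        (P N [set w | (C * a N)%:E < X N w] <= eps%:E)%E) ->
    (forall eps : R, 0 < eps -> exists2 C : R, 0 < C &
      exists N0, forall N, (N0 <= N)%N ->
        (P N [set w | X N w < (a N / C)%:E] <= eps%:E)%E) ->
  bigTheta_proba P X a.
Proof.
move=> X0 a0 up lo; split => eps e0.
  have [C C0 [N0 h]] := up eps e0; exists C => //; exists N0 => N /h.
  by under [X in P N X]eq_set do rewrite -(gee0_abs (X0 N _)).
have [C C0 [N0 h]] := lo eps e0; exists C => //; exists (maxn N0 2) => N.
rewrite geq_max => /andP[/h {}h N2]; rewrite mulr1.
rewrite (_ : [set w | _] = [set w | (X N w < (a N / C)%:E)%E])//.
by apply/seteqP; split => w /=; rewrite (abse_ratio_gt C0 (a0 N N2) (X0 N w)).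
Qed.

(** * The mesh ratio *)

Section MeshRatio.
Variables (R : realType) (d N : nat).
Implicit Types x : 'I_N -> 'rV[R]_d.

Lemma mesh_ratio_ge0 x : (0 <= mesh_ratio x)%E.
Proof.
rewrite /mesh_ratio; case: ifP => // _.
have h : (0 <= 2%:E * covering_radius x)%E by rewrite mule_ge0 ?covering_ge0.
apply: mule_ge0 => //; rewrite inve_ge0; exact: separation_ge0.
Qed.

Hypothesis N_ge2 : (2 <= N)%N.

Lemma separation_real x : exists2 s : R, 0 <= s & separation x = s%:E.
Proof.
have := separation_fin x N_ge2; have := separation_ge0 x.
by case: (separation x) => // s; rewrite lee_fin; exists s.
Qed.

Lemma mesh_ratio_gt x (t : R) : (t%:E < mesh_ratio x)%E =
  (separation x == 0%E) || (t%:E * separation x < 2%:E * covering_radius x)%E.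
Proof.
have [s s0 se] := separation_real x; rewrite /mesh_ratio se.
have [->|sn0] := eqVneq s 0; first by rewrite eqxx ltry.
rewrite eqe (negbTE sn0)/= inver (negbTE sn0) lte_pdivlMr//.
by rewrite lt_neqAle eq_sym sn0.
Qed.

Lemma mesh_ratio_lt x (t : R) : (mesh_ratio x < t%:E)%E =
  (separation x != 0%E) && (2%:E * covering_radius x < t%:E * separation x)%E.
Proof.
have [s s0 se] := separation_real x; rewrite /mesh_ratio se.
have [->|sn0] := eqVneq s 0; first by rewrite eqxx ltNge leey.
rewrite eqe (negbTE sn0)/= inver (negbTE sn0) lte_pdivrMr//.
by rewrite lt_neqAle eq_sym sn0.
Qed.
End MeshRatio.

Section Mesh.
Variables (R : realType) (dO : measure_display) (Omega : measurableType dO).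
Variables (P : probability Omega R) (d N : nat).
Variables (perm : 'I_d -> Omega -> 'S_N) (U : 'I_N -> 'I_d -> {RV P >-> R}).
Hypothesis H : lhs_randomness perm U.
Local Notation X := (lhs_sample perm U).
Hypothesis N_ge2 : (2 <= N)%N.

Lemma measurable_mesh_ratio : measurable_fun [set: Omega] (fun w => mesh_ratio (X w)).
Proof.
have msep := measurable_separation H; have mcov := measurable_covering H.
apply: emeasurable_fun_gt => t.
have -> : [set w | (t%:E < mesh_ratio (X w))%E] =
    ([set: Omega] `&` [set w | separation (X w) = 0%E]) `|`
    ([set: Omega] `&` [set w | t%:E * separation (X w) < 2%:E * covering_radius (X w)])%E.
  apply/seteqP; split => w /=; rewrite (mesh_ratio_gt N_ge2).
    by case/orP => [/eqP|]; [left|right].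
  by case=> -[_ h]; apply/orP; [left; apply/eqP|right].
apply: measurableU.
  exact: measurable_eqe.
by apply: measurable_lte => //; apply: emeasurable_funM.
Qed.

Let tail_gt (f : Omega -> \bar R) (t : R) : measurable_fun [set: Omega] f ->
  measurable [set w | (t%:E < f w)%E].
Proof.
by move=> mf; have := emeasurable_fun_o_infty measurableT mf t%:E; rewrite setTI.
Qed.

Let tail_lt (f : Omega -> \bar R) (t : R) : measurable_fun [set: Omega] f ->
  measurable [set w | (f w < t%:E)%E].
Proof.
by move=> mf; have := emeasurable_fun_infty_o measurableT mf t%:E; rewrite setTI.
Qed.

Let prob_le2 (A B C : set Omega) : measurable A -> measurable B -> measurable C ->
  A `<=` B `|` C -> (P A <= P B + P C)%E.
Proof.
move=> mA mB mC AB; apply: le_trans (measureU2 _ mB mC).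
by apply: le_measure; rewrite ?inE//; exact: measurableU.
Qed.

Lemma mesh_ratio_tail_gt (s h : R) : 0 < s ->
  (P [set w | (2 * h / s)%:E < mesh_ratio (X w)] <=
   P [set w | h%:E < covering_radius (X w)] +
   P [set w | separation (X w) < s%:E])%E.
Proof.
move=> s0; apply: prob_le2.
- exact/tail_gt/measurable_mesh_ratio.
- exact/tail_gt/measurable_covering.
- exact/tail_lt/measurable_separation.
move=> w /= hm; apply: contrapT => /not_orP[/negP + /negP]; rewrite -!leNgt => hc hs.
move: hm; rewrite (mesh_ratio_gt N_ge2).
have [q q0 qe] := separation_real N_ge2 (X w); rewrite qe in hs *.
rewrite lee_fin in hs.
have q1 : 0 < q by exact: lt_le_trans hs.
rewrite eqe gt_eqF//= ltNge => /negP; apply.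
apply: (@le_trans _ _ (2%:E * h%:E)%E); first by rewrite lee_pmul2l.
rewrite -!EFinM lee_fin mulrAC ler_pdivlMr//.
have h0 : 0 <= h by rewrite -lee_fin (le_trans (covering_ge0 _) hc).
by rewrite ler_wpM2l// mulr_ge0.
Qed.

Lemma mesh_ratio_tail_lt (s h : R) : 0 < s -> 0 <= h ->
  (P [set w | mesh_ratio (X w) < (2 * h / s)%:E] <=
   P [set w | covering_radius (X w) < h%:E] +
   P [set w | s%:E < separation (X w)])%E.
Proof.
move=> s0 h0; apply: prob_le2.
- exact/tail_lt/measurable_mesh_ratio.
- exact/tail_lt/measurable_covering.
- exact/tail_gt/measurable_separation.
move=> w /= hm; apply: contrapT => /not_orP[/negP + /negP]; rewrite -!leNgt => hc hs.
move: hm; rewrite (mesh_ratio_lt N_ge2) => /andP[_]; rewrite ltNge => /negP; apply.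
have [q q0 qe] := separation_real N_ge2 (X w); rewrite qe in hs *.
rewrite lee_fin in hs.
apply: (@le_trans _ _ (2%:E * h%:E)%E); last by rewrite lee_pmul2l.
rewrite -!EFinM lee_fin mulrAC ler_pdivrMr//.
by rewrite ler_wpM2l// mulr_ge0.
Qed.
End Mesh.

(** * The theorem *)

Lemma powR_mesh_scale (R : realType) d N : (0 < d)%N -> (2 <= N)%N ->
  N%:R `^ (d%:R^-1) * (ln N%:R) `^ (d%:R^-1) =
  (ln N%:R / N%:R) `^ (d%:R^-1) / N%:R `^ (- (2 / d%:R)) :> R.
Proof.
move=> d0 N2; have NR : 0 < N%:R :> R by rewrite ltr0n (leq_trans _ N2).
have L0 : 0 < ln N%:R :> R by rewrite ln_gt0// ltr1n.
have e1 := powR_sep_scale R d0 (ltnW N2).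
have e2 := powR_rootK d0 (ltW NR).
have e3 := powR_rootK d0 (ltW L0).
have e4 := powR_rootK d0 (ltW (divr_gt0 L0 NR)).
set u := N%:R `^ (- (2 / d%:R)) in e1 *.
set x := N%:R `^ d%:R^-1 in e2 *; set y := ln N%:R `^ d%:R^-1 in e3 *.
set z := (ln N%:R / N%:R) `^ d%:R^-1 in e4 *.
have u0 : 0 <= u by exact: powR_ge0.
have x0 : 0 <= x by exact: powR_ge0.
have y0 : 0 <= y by exact: powR_ge0.
have z0 : 0 <= z by exact: powR_ge0.
have ud : u ^+ d != 0.
  by apply/eqP => e; move/eqP: e1; rewrite e mul0r eq_sym oner_eq0.
have e5 : (u ^+ d)^-1 = N%:R ^+ 2 by apply: (mulfI ud); rewrite divff.
clearbody u x y z.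
apply/eqP; rewrite -(eqrXn2 d0) ?divr_ge0 ?mulr_ge0//; apply/eqP.
rewrite exprMn [in RHS]exprMn exprVn e2 e3 e4 e5.
by rewrite expr2 mulrA divfK ?gt_eqF// mulrC.
Qed.

Theorem theorem3p6 (R : realType) (d : nat) (hd : (2 <= d)%N)
    (dO : nat -> measure_display)
    (Omega : forall N, measurableType (dO N))
    (P : forall N, probability (Omega N) R)
    (perm : forall N, 'I_d -> Omega N -> 'S_N)
    (U : forall N, 'I_N -> 'I_d -> {RV (P N) >-> R})
    (hlhs : forall N, (2 <= N)%N -> lhs_randomness (perm N) (U N)) :
  [/\ bigTheta_proba P
        (fun N w => separation (lhs_sample (perm N) (U N) w))
        (fun N => N%:R `^ (- (2 / d%:R))),
      bigTheta_proba P
        (fun N w => covering_radius (lhs_sample (perm N) (U N) w))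
        (fun N => (ln N%:R / N%:R) `^ (d%:R^-1))
    & bigTheta_proba P
        (fun N w => mesh_ratio (lhs_sample (perm N) (U N) w))
        (fun N => N%:R `^ (d%:R^-1) * (ln N%:R) `^ (d%:R^-1))].
Proof.
have d0 : (0 < d)%N by exact: leq_trans hd.
set a1 : nat -> R := fun N => N%:R `^ (- (2 / d%:R)).
set a2 : nat -> R := fun N => (ln N%:R / N%:R) `^ (d%:R^-1).
set a3 : nat -> R := fun N => N%:R `^ (d%:R^-1) * (ln N%:R) `^ (d%:R^-1).
have NR N : (2 <= N)%N -> 0 < N%:R :> R by move=> h; rewrite ltr0n (leq_trans _ h).
have ln0 N : (2 <= N)%N -> 0 < ln N%:R :> R by move=> h; rewrite ln_gt0// ltr1n.
have a1_gt0 N : (2 <= N)%N -> 0 < a1 N by move=> h; rewrite powR_gt0// NR.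
have a2_gt0 N : (2 <= N)%N -> 0 < a2 N.
  by move=> h; rewrite powR_gt0// divr_gt0 ?ln0 ?NR.
have a1E N : (2 <= N)%N -> a1 N ^+ d * N%:R ^+ 2 = 1.
  by move=> h; rewrite powR_sep_scale// (leq_trans _ h).
have a2E N : (2 <= N)%N -> a2 N ^+ d * N%:R = ln N%:R.
  move=> h; rewrite powR_rootK ?divfK ?gt_eqF ?NR//.
  by rewrite divr_ge0 ?(ltW (ln0 _ h)) ?(ltW (NR _ h)).
have a3_gt0 N : (2 <= N)%N -> 0 < a3 N.
  by move=> h; rewrite mulr_gt0 ?powR_gt0 ?ln0 ?NR.
have a3E N : (2 <= N)%N -> a3 N = a2 N / a1 N.
  by move=> h; exact: powR_mesh_scale.
have sep_up eps : 0 < eps -> exists2 C : R, 0 < C & exists N0, forall N, (N0 <= N)%N ->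
    (P N [set w | (C * a1 N)%:E < separation (lhs_sample (perm N) (U N) w)] <= eps%:E)%E.
  move=> e0; pose C : R := 4 + 36 / eps.
  have C4 : 4 <= C by rewrite lerDl divr_ge0// ltW.
  have [N0 hN] := eventually_ln_ge (Num.max ((2 * C) ^+ d)
    (Num.max (12 * d)%:R ((12 * d%:R + 6 * 4 ^+ d) * 2 / eps))).
  exists C; first by lra.
  exists N0 => N /hN[N2 + _]; rewrite !ge_max ler_nat => /and3P[N3 N4 N5].
  apply: le_trans (separation_upper (hlhs _ N2) hd N2 (a1_gt0 _ N2) (a1E _ N2) C4 N3 N4) _.
  rewrite lee_fin [leRHS](splitr eps) lerD//.
    rewrite ler_pdivrMr ?NR// mulrAC ler_pdivlMr// [leRHS]mulrC.
    by rewrite -ler_pdivrMr.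
  rewrite ler_pdivlMr// -[leLHS]mulrA.
  have C0 : 0 < C by lra.
  have : 36 <= eps * C.
    by rewrite mulrDr [eps * (_ / _)]mulrC divfK ?gt_eqF// lerDr mulr_ge0// ltW.
  move=> h36; rewrite mulrA mulrAC mulrA ler_pdivrMr//; lra.
have sep_lo eps : 0 < eps -> exists2 C : R, 0 < C & exists N0, forall N, (N0 <= N)%N ->
    (P N [set w | separation (lhs_sample (perm N) (U N) w) < (a1 N / C)%:E] <= eps%:E)%E.
  move=> e0; pose C : R := 4 + 4 / eps.
  have C4 : 4 <= C by rewrite lerDl divr_ge0// ltW.
  exists C; first by lra.
  exists 2%N => N N2.
  apply: le_trans (separation_lower (hlhs _ N2) hd N2 (a1_gt0 _ N2) (a1E _ N2) C4) _.
  rewrite lee_fin ler_pdivrMr; last by lra.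
  by rewrite mulrDr [eps * (_ / _)]mulrC divfK ?gt_eqF// lerDr mulr_ge0// ltW.
have cov_up eps : 0 < eps -> exists2 C : R, 0 < C & exists N0, forall N, (N0 <= N)%N ->
    (P N [set w | (C * a2 N)%:E < covering_radius (lhs_sample (perm N) (U N) w)] <= eps%:E)%E.
  move=> e0; pose C : R := 8 * d.+1%:R.
  have C0 : 0 < C by rewrite mulr_gt0.
  have [N0 hN] := eventually_ln_ge (Num.max 1 (Num.max eps^-1 (4 * (C / 2) ^+ d))).
  exists C => //; exists N0 => N /hN[N2]; rewrite !ge_max.
  move=> /and3P[_ N3 _] /and3P[L1 _ L2].
  have Ca : C * a2 N <= 2.
    rewrite -ler_pdivlMl// -(ler_pXn2r d0) ?nnegrE ?(ltW (a2_gt0 _ N2)) ?mulr_ge0 ?invr_ge0 ?(ltW C0)//.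
    rewrite -(ler_pM2r (NR _ N2)) (a2E _ N2).
    have h : ln N%:R ^+ 2 / 4 <= N%:R :> R.
      rewrite -[leRHS](lnK (_ : N%:R \is Num.pos)) ?posrE ?NR//.
      apply: le_trans (sqr_le_expR (ltW (ln0 _ N2))).
      by rewrite exprMn exprVn; lra.
    have k0 : 0 < (C / 2) ^+ d by rewrite exprn_gt0// divr_gt0.
    have -> : C^-1 * 2 = (C / 2)^-1 by rewrite invf_div mulrC.
    rewrite exprVn mulrC ler_pdivlMr//.
    by apply: le_trans h; move: (ln0 _ N2) L2; nra.
  apply: le_trans (covering_upper (hlhs _ N2) hd N2 (a2_gt0 _ N2) (a2E _ N2) L1 (erefl C) Ca) _.
  by rewrite lee_fin -[leRHS]invrK lef_pV2 ?posrE ?invr_gt0 ?NR.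
have cov_lo eps : 0 < eps -> exists2 C : R, 0 < C & exists N0, forall N, (N0 <= N)%N ->
    (P N [set w | covering_radius (lhs_sample (perm N) (U N) w) < (a2 N / C)%:E] <= eps%:E)%E.
  move=> e0; exists (32 * d%:R); first by rewrite mulr_gt0// ltr0n.
  have [N0 hN] := eventually_ln_ge (Num.max 1 (Num.max ((8 * d%:R) ^+ d) (16 / eps ^+ d))).
  exists N0 => N /hN[N2]; rewrite !ge_max => /and3P[_ N3 _] /and3P[L1 _ L2].
  exact: (covering_lower (hlhs _ N2) hd N2 e0 (a2_gt0 _ N2) (a2E _ N2) L1 N3 L2).
split; apply: bigTheta_of_tails => //.
- by move=> N w; exact: separation_ge0.
- by move=> N w; exact: covering_ge0.
- by move=> N w; exact: mesh_ratio_ge0.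
- move=> eps e0; have e2 : 0 < eps / 2 by rewrite divr_gt0.
  have [C C0 [N0 hC]] := cov_up _ e2; have [D D0 [N1 hD]] := sep_lo _ e2.
  exists (2 * C * D); first by rewrite !mulr_gt0.
  exists (maxn 2 (maxn N0 N1)) => N; rewrite !geq_max => /and3P[N2 /hC{}hC /hD{}hD].
  have -> : 2 * C * D * a3 N = 2 * (C * a2 N) / (a1 N / D).
    by rewrite a3E//; field; rewrite !gt_eqF// a1_gt0.
  apply: le_trans (mesh_ratio_tail_gt (hlhs _ N2) N2 _ _) _.
    by rewrite divr_gt0// a1_gt0.
  by rewrite [eps]splitr EFinD leeD.
- move=> eps e0; have e2 : 0 < eps / 2 by rewrite divr_gt0.
  have [C C0 [N0 hC]] := cov_lo _ e2; have [D D0 [N1 hD]] := sep_up _ e2.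
  exists (C * D / 2); first by rewrite !mulr_gt0.
  exists (maxn 2 (maxn N0 N1)) => N; rewrite !geq_max => /and3P[N2 /hC{}hC /hD{}hD].
  have -> : a3 N / (C * D / 2) = 2 * (a2 N / C) / (D * a1 N).
    by rewrite a3E//; field; rewrite !gt_eqF// a1_gt0.
  apply: le_trans (mesh_ratio_tail_lt (hlhs _ N2) N2 _ _) _.
  - by rewrite mulr_gt0// a1_gt0.
  - by rewrite divr_ge0 ?(ltW (a2_gt0 _ N2))// ltW.
  by rewrite [eps]splitr EFinD leeD.
Qed.
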